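(* For all $f\in C(S)$, $\theta(f)=\langle[F(f)]_{\infty}\,|\,[u(\theta)]_{0}\rangle$.
   Context: Inner products are linear in the second argument. $H$ is a (nonzero) separable complex Hilbert space and $A=qV$ with $q\in\mathbb{C}\setminus\{0\}$ and $V$ unitary on $H$; thus $A^{*}A=AA^{*}=r_{A}I$ with $r_A=|q|^2$. $\phi\in H$ is a fixed unit vector that is cyclic: $\{P(A,A^{*})(\phi)\mid P\in\mathbb{C}[X,Y]\}$ is dense in $H$. For $N\in\omega$: $H_N$ is the span of $\{A^{i}(A^{*})^{j}\phi\mid i\le N,\ j\le N\}$, $H_N^{-}$ the span of those with $i<N,\ j\le N$, $H_N^{+}$ the span of those with $0<i\le N,\ j\le N$; $W^{\pm}$ are the orthogonal complements of $H_N^{\pm}$ in $H_N$ (of equal dimension). Fix a unitary $U_N:W^{-}\to W^{+}$ and let $A_N$ be the linear operator on $H_N$ with $A_N(u)=A(u)$ for $u\in H_N^{-}$ and $A_N(u)=\sqrt{r_A}\,U_N(u)$ for $u\in W^{-}$; $A_N$ is normal. $D_N=\dim H_N$ and $u_N(n)$, $n<D_N$, is an orthonormal basis of eigenvectors of $A_N$ with eigenvalues $\lambda_N(n)$, chosen so that $\xi_N(n)=\langle u_N(n)|\phi\rangle$ is a non-negative real. $M$ is a natural number strictly greater than $\|A\|$ and $\sqrt{r_A}$, $S=\{\lambda\in\mathbb{C}\mid |\mathrm{Re}\,\lambda|\le M,\ |\mathrm{Im}\,\lambda|\le M\}$, and $C(S)$ is the space of continuous functions $S\to\mathbb C$. $\sigma(A)$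 is the spectrum of $A$. $\mathcal{U}$ is an ultrafilter on $\omega$ such that for all $m\ge1$, $\{N\ge1\mid\sqrt N\in\omega,\ m\text{ divides }\sqrt N\}\in\mathcal{U}$. $H^{u}=\prod_NH_N/\mathcal{U}$, $\langle\cdot|\cdot\rangle^u$ is the ultraproduct of the inner products, with values in $\mathbb C^u=\mathbb C^\omega/\mathcal U$. An element of $H^u$ need only be specified on a set of $N$ belonging to $\mathcal U$. For $f\in C(S)$, $F_N(f)=\sum_{n<D_N}\xi_N(n)f(\lambda_N(n))u_N(n)$ and $F(f)=(F_N(f))_N/\mathcal U\in H^u$. Measure: for $X\subseteq\mathbb{C}$, $\mu_N(X)=\sum\{\xi_N(n)^2\mid n<D_N,\ \lambda_N(n)\in X\}$ and $\mu^{\mathrm n}(X)=\lim_{\mathcal U}\mu_N(X)$. For $r\in[-M,M]$, $I_r^\varepsilon=\{\lambda\in S\mid|\mathrm{Re}\,\lambda-r|<\varepsilon\}$, $J_r^\varepsilon=\{\lambda\in S\mid|\mathrm{Im}\,\lambda-r|<\varepsilon\}$; $r$ is nice if for all $\delta>0$ there is $\varepsilon>0$ with $\mu^{\mathrm n}(I_r^\varepsilon),\mu^{\mathrm n}(J_r^\varepsilon)<\delta$. $NI$ is a fixed countable dense subset of $[-M,M]$ of nice reals with $\pm M\in NI$. $Sq^*$ is the family of sets $\{\lambda\in S\mid r_0<\mathrm{Re}\,\lambda<r_1,\ r_2<\mathrm{Im}\,\lambda<r_3\}$, $r_0,\dots,r_3\in NI$. For $Y\subseteq\mathrm{Int}(S)$,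 $\mu^*(Y)=\inf\{\sum_{i}\mu^{\mathrm n}(X_i)\mid X_i\in Sq^*,\ Y\subseteq\bigcup_{i<\omega}X_i\}$; for $Y\subseteq\mathbb C$, $\mu^*(Y)=\mu^*(Y\cap\mathrm{Int}(S))$; $\mu$ is the restriction of $\mu^*$ to the Carathéodory measurable sets, a Borel probability measure on $S$. Refinements: $Sq_n\subseteq Sq^*$ ($n<\omega$) are finite sets with (a) elements of $Sq_n$ are disjoint; (b) $\bigcup_{X\in Sq_n}\overline X=S$; (c) for all $X\in Sq^*$, $m<\omega$ there are $n>m$ and $Z\subseteq Sq_n$ with $\overline X=\bigcup_{Y\in Z}\overline Y$; (d) if $n<m$ and $X\in Sq_n$ there is $Z\subseteq Sq_m$ with $\overline X=\bigcup_{Y\in Z}\overline Y$; (e) each element of $Sq_n$ is a rectangle $\{\lambda\in S\mid r_0<\mathrm{Re}\,\lambda<r_1,\ r_2<\mathrm{Im}\,\lambda<r_3\}$ with $r_0,\dots,r_3\in NI$, $0<r_1-r_0<2M/(n+1)$ and $0<r_3-r_2<2M/(n+1)$. The space $H^m_0$: for $v=(\sum_ka^N_ku_N(k))_N/\mathcal U$, $\|v\|_0^u$ is the class of $(\sum_k\xi_N(k)|a_k^N|)_N$. A set $Y\subseteq Sq_n$ is good if $S_1^Y=\bigcup_{R\in Sq_n\setminus Y}\overline R$ has positive distance from $\sigma(A)$ (the empty set counts as having positive distance). $v$ is $0$-good if for every $n$ and every good $Y\subseteq Sq_n$, $(\sum_{\lambda_N(k)\in S_1^Y}\xi_N(k)|a^N_k|)_N/\mathcal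 U$ is infinitesimal. $H^{m0}$ is the set of $0$-good $v$ with $\|v\|_0^u$ bounded by a natural number, $u\sim_0v$ iff $\|u-v\|_0^u$ is infinitesimal, $H^m_0=H^{m0}/\sim_0$, and $[v]_0$ denotes classes. The space $H^m_\infty$: for closed $X\subseteq\mathbb C$, $\|\sum_na_nu_N(n)\|^X_\infty=\sup\{\xi_N(n)^{-1}|a_n|\mid\lambda_N(n)\in X\}$ (with $0^{-1}=0$). For $\varepsilon>0$, $X_\varepsilon$ is the set of points at distance $\le\varepsilon$ from $\sigma(A)$, and for $v=(v_N)_N/\mathcal U$, $\|v\|^\varepsilon_\infty=\lim_{\mathcal U}\|v_N\|^{X_\varepsilon}_\infty$ (or $\infty$ if there is no finite ultralimit). If there are $p<\omega$ and $Z\in\mathcal U$ with $|a^N_k|\xi_N(k)^{-1}<p$ for all $N\in Z$, $k<D_N$, then $\|v\|_\infty=\lim_{\varepsilon\to0}\|v\|^\varepsilon_\infty$; otherwise $\|v\|_\infty=\infty$. $H^{m\infty}=\{v\in H^u\mid\|v\|_\infty<\infty\}$, $u\sim_\infty v$ iff $\|u-v\|_\infty=0$, $H^m_\infty=H^{m\infty}/\sim_\infty$, and $[v]_\infty$ denotes classes. Pairing: $\langle[f]_k|[g]_r\rangle=q\in\mathbb C$ if $\langle f'|g'\rangle^u$ is infinitely close to $q$ for all $f'\in[f]_k$, $g'\in[g]_r$ (and $=\infty$ if there is no such $q$). Generalized distributions: with $\|f\|^\sigma_\infty=\sup_{\lambda\in\sigma(A)}|f(\lambda)|$, a generalized distribution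 is an antilinear $\theta:C(S)\to\mathbb C$ for which there is $K<\omega$ with $|\theta(f)|\le K\|f\|_\infty^\sigma$ for all $f$. Fix one such $\theta$. For $X\subseteq\mathbb C$, an $X$-function is an $f\in C(S)$ with $|f|\le1$ on $S$ and $f=0$ on $S\setminus X$. The line $I_r=\{\lambda\in S\mid\mathrm{Re}\,\lambda=r\}$ is very good for $\theta$ if for all $\delta>0$ there is $\varepsilon>0$ with $|\theta(f)|<\delta$ for all $I_r^\varepsilon$-functions $f$, and for all $\delta>0$ there is $\varepsilon>0$ with $\mu^{\mathrm n}(I_r^\varepsilon)<\delta$; similarly for $J_r=\{\lambda\in S\mid\mathrm{Im}\,\lambda=r\}$. Fix reals $r^n_i\in[-M,M]$ ($n<\omega$, $i<2^{n+2}+1$) with $r^n_i<r^n_{i+1}$, $r^n_{i+1}-r^n_i<2M/(n+1)$; all $I_{r^n_i},J_{r^n_i}$ very good for $\theta$; $r^0_0=-M$, $r^0_4=M$; and each $r^n_i$ equal to some $r^{n+1}_j$. Put $B^n_{ij}=\{\lambda\in S\mid r^n_i<\mathrm{Re}\,\lambda<r^n_{i+1},\ r^n_j<\mathrm{Im}\,\lambda<r^n_{j+1}\}$ for $i,j<2^{n+2}$ and $R^n_\varepsilon=\bigcup_{i<2^{n+2}+1}(I^\varepsilon_{r^n_i}\cup J^\varepsilon_{r^n_i})$ (always with $\varepsilon$ so small that $r^n_j+\varepsilon<r^n_{j+1}-\varepsilon$). $\varepsilon>0$ is very nice for $n$ if for every $i<2^{n+2}$ each of $r^n_i\pm\varepsilon$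 is nice or outside $[-M,M]$. $\theta(B^n_{ij},1)=\lim_{\varepsilon\to0}\theta(f_\varepsilon)$, where $f_\varepsilon$ is any $B^n_{ij}$-function equal to $1$ at all $x$ with $r^n_i+\varepsilon<\mathrm{Re}\,x<r^n_{i+1}-\varepsilon$, $r^n_j+\varepsilon<\mathrm{Im}\,x<r^n_{j+1}-\varepsilon$ (the limit does not depend on choices). A pair $n:\omega\to\omega$, $\varepsilon:\omega\to\mathbb R_{>0}$ is $\theta$-good if (i) for all $m>0$, $\{N\mid n(N)>m,\ \varepsilon(N)<1/m\}\in\mathcal U$; (ii) there is $U(\theta,n,\varepsilon)\in\mathcal U$ such that for all $N$ in it with $n=n(N)>0$, putting $\varepsilon=\varepsilon(N)$, $\delta'=\min\{\mu_N(B^n_{ij})\mid\mu(B^n_{ij})>0\}$, $\delta=\delta'/2^{3(n+2)}$: (a) $|\theta(f)|<\delta$ for all $R^n_\varepsilon$-functions $f$, (b) $\sum_{\lambda_N(i)\in R^n_\varepsilon}\xi_N(i)^2<\delta$, (c) $|\mu_N(B^n_{ij})-\mu(B^n_{ij})|<\delta$ for all $i,j<2^{n+2}$; (iii) $\varepsilon(N)$ is very nice for $n(N)$. Fix a $\theta$-good pair $(n,\varepsilon)$ with $U(\theta,n,\varepsilon)=\omega$. Then $u(\theta)=(u_N(\theta))_N/\mathcal U\in H^u$, where, with $n=n(N)$, $$u_N(\theta)=\sum_{\mu(B^n_{ij})\ne0}\ \sum_{\lambda_N(k)\in B^n_{ij}}\frac{\xi_N(k)\,\theta(B^n_{ij},1)}{\mu_N(B^n_{ij})}\,u_N(k).$$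 *)

(* Defs.v *)
From HB Require Import structures.
From mathcomp Require Import all_boot all_order all_algebra.
From mathcomp Require Import all_classical all_reals all_analysis.
From mathcomp Require Import complex.

Set Implicit Arguments.
Unset Strict Implicit.
Unset Printing Implicit Defensive.

Import Order.TTheory GRing.Theory Num.Theory.
Import numFieldNormedType.Exports.

Local Open Scope quotient_scope.
Local Open Scope classical_set_scope.
Local Open Scope ring_scope.

(* The library attaches the norm topology to abstract numClosedFieldTypes only;
   give R[i] the same structures, copied from the regular module R[i]^o. *)
HB.instance Definition _ (R : realType) := GRing.ComAlgebra.copy R[i] R[i]^o.
HB.instance Definition _ (R : realType) := Vector.copy R[i] R[i]^o.
HB.instance Definition _ (R : realType) := NormedModule.copy R[i] R[i]^o.

(* The norm of a normed R[i]-module has values in R[i]; cabs is the modulus as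
   an element of R, and `|z| = (cabs z)%:C. *)
Notation cabs := ComplexField.Normc.normc.

Section ultraproduct.
Variables (U : set_system nat) (FU : UltraFilter U).

Section carrier.
Variable T : nat -> Type.

Definition ultra_eq (x y : {classic (forall N, T N)}) : bool :=
  `[< U [set N | x N = y N] >].

Lemma ultra_eq_refl : reflexive ultra_eq.
Proof.
by move=> x; apply/asboolP; rewrite (_ : mkset _ = setT);
  [exact: filterT | exact/seteqP].
Qed.

Lemma ultra_eq_sym : symmetric ultra_eq.
Proof.
by move=> x y; apply/asboolP/asboolP; apply: filterS => N /= ->.
Qed.

Lemma ultra_eq_trans : transitive ultra_eq.
Proof.
move=> y x z /asboolP xy /asboolP yz; apply/asboolP.
by apply: filterS2 xy yz => N /= -> ->.
Qed.

Canonical ultra_equiv :=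
  EquivRel ultra_eq ultra_eq_refl ultra_eq_sym ultra_eq_trans.

Definition ultraproduct : Type := {eq_quot ultra_equiv}.

Definition ultra_class (x : forall N, T N) : ultraproduct :=
  \pi_({eq_quot ultra_equiv}) (x : {classic (forall N, T N)}).

Definition ultra_repr (x : ultraproduct) : forall N, T N :=
  repr (x : {eq_quot ultra_equiv}).

End carrier.

Definition ultrapower (T : Type) := ultraproduct (fun _ => T).

Definition infinitely_close (K : numDomainType) (x : ultrapower K) (q : K) :=
  forall e : K, 0 < e -> U [set N | `|ultra_repr x N - q| < e].

Definition infinitesimal (K : numDomainType) (x : ultrapower K) :=
  infinitely_close x 0.

Definition nat_bounded (K : numDomainType) (x : ultrapower K) :=
  exists p : nat, U [set N | `|ultra_repr x N| <= p%:R].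

End ultraproduct.

Section hilbert.
Variables (R : realType) (H : completeNormedModType R[i]).

Definition separable := exists2 D : set H, countable D & dense D.

(* Together with completeness of H, this makes H a complex Hilbert space. *)
Record inner_product := InnerProduct {
  ip :> H -> H -> R[i];
  ip_linear : forall x a y z, ip x (a *: y + z) = a * ip x y + ip x z;
  ip_conj : forall x y, ip y x = (ip x y)^*;
  ip_norm : forall x, `|x| ^+ 2 = ip x x }.

Definition span (B : set H) : set H :=
  [set x | exists (m : nat) (c : 'I_m -> R[i]) (y : 'I_m -> H),
     (forall i, B (y i)) /\ x = \sum_(i < m) c i *: y i].

Lemma span0 (B : set H) : span B 0.
Proof.
exists 0%N, (fun _ => 0), (fun _ => 0); split; first by case.
by rewrite big_ord0.
Qed.

Definition linear_on (W : set H) (T : H -> H) :=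
  forall a x y, W x -> W y -> T (a *: x + y) = a *: T x + T y.

Definition unitary_on (ip : inner_product) (W W' : set H) (T : H -> H) :=
  [/\ linear_on W T, T @` W = W' &
      forall x y, W x -> W y -> ip (T x) (T y) = ip x y].

Definition op_norm (T : H -> H) : R :=
  sup [set complex.Re `|T x| | x in [set x | `|x| <= 1]].

Definition spectrum (T : H -> H) : set R[i] :=
  [set l | ~ exists B : {linear H -> H}, continuous B /\
     forall x, B (T x - l *: x) = x /\ T (B x) - l *: B x = x].

Definition orth_compl (ip : inner_product) (W W' : set H) : set H :=
  [set x | W x /\ forall y, W' y -> ip y x = 0].

(* P(A, A^* )(phi) = \sum_(i, j) P_ij A^i (A^* )^j phi, for P in C[X, Y]. *)
Definition poly2_apply (A As : H -> H) (phi : H) (P : {poly {poly R[i]}}) : H :=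
  \sum_(i < size P) \sum_(j < size P`_i)
    P`_i`_j *: iter i A (iter j As phi).

(* The operator A = qV, its adjoint, and the cyclic unit vector phi. *)
Record cyclic_operator (ip : inner_product) := CyclicOperator {
  opq : R[i];
  opV : {linear H -> H};
  opAdj : H -> H;
  cyc : H;
  opq_neq0 : opq != 0;
  opV_unitary : unitary_on ip setT setT opV;
  opAdj_adjoint : forall x y, ip (opAdj x) y = ip x (opq *: opV y);
  cyc_unit : `|cyc| = 1;
  cyc_cyclic : dense (range (poly2_apply (fun x => opq *: opV x) opAdj cyc)) }.

End hilbert.

Section operator.
Variables (R : realType) (H : completeNormedModType R[i]).
Variables (ip : inner_product H) (E : cyclic_operator ip).

Definition opA : H -> H := fun x => opq E *: opV E x.
Definition rA : R := cabs (opq E) ^+ 2.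
Definition sigmaA : set R[i] := spectrum opA.

Definition word (i j : nat) : H := iter i opA (iter j (opAdj E) (cyc E)).

Definition HN (N : nat) : set H :=
  span [set x | exists i j, [/\ (i <= N)%N, (j <= N)%N & x = word i j]].
Definition HN_minus (N : nat) : set H :=
  span [set x | exists i j, [/\ (i < N)%N, (j <= N)%N & x = word i j]].
Definition HN_plus (N : nat) : set H :=
  span [set x | exists i j, [/\ (0 < i <= N)%N, (j <= N)%N & x = word i j]].

Definition W_minus (N : nat) : set H := orth_compl ip (HN N) (HN_minus N).
Definition W_plus (N : nat) : set H := orth_compl ip (HN N) (HN_plus N).

(* U_N and A_N are total functions of which only the restrictions to W^- and
   to H_N matter. Since apu N is an orthonormal basis of H_N, apD N = dim H_N. *)
Record finite_models := FiniteModels {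
  apU : nat -> H -> H;
  apA : nat -> H -> H;
  apD : nat -> nat;
  apu : forall N, 'I_(apD N) -> H;
  apl : forall N, 'I_(apD N) -> R[i];
  apM : nat;
  apU_unitary : forall N, unitary_on ip (W_minus N) (W_plus N) (apU N);
  apA_linear : forall N, linear_on (HN N) (apA N);
  apA_minus : forall N x, HN_minus N x -> apA N x = opA x;
  apA_W : forall N x, W_minus N x ->
    apA N x = (Num.sqrt rA)%:C%C *: apU N x;
  apu_orthonormal : forall N k l, ip (@apu N k) (@apu N l) = (k == l)%:R;
  apu_basis : forall N, span (range (@apu N)) = HN N;
  apu_eigen : forall N k, apA N (@apu N k) = @apl N k *: @apu N k;
  apu_cyc_ge0 : forall N k, 0 <= ip (@apu N k) (cyc E);
  apM_norm : op_norm opA < apM%:R;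
  apM_rA : Num.sqrt rA < apM%:R }.

End operator.

Arguments apu {R H ip E} _ {N} _.
Arguments apl {R H ip E} _ {N} _.

Section model.
Variables (R : realType) (H : completeNormedModType R[i]).
Variables (ip : inner_product H) (E : cyclic_operator ip).
Variables (X : finite_models E) (U : set_system nat).

Local Notation D := (apD X).
Local Notation lam := (apl X).
Local Notation M := ((apM X)%:R : R).

(* <u_N(n)|phi> is a non-negative real by apu_cyc_ge0. *)
Definition xi (N : nat) (k : 'I_(D N)) : R := complex.Re (ip (apu X k) (cyc E)).

Definition square : set R[i] :=
  [set l | `|complex.Re l| <= M /\ `|complex.Im l| <= M].

(* An element f of C(S) is given by a function R[i] -> R[i] whose restriction
   to S is continuous. *)
Definition CS (f : R[i] -> R[i]) := {within square, continuous f}.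

Definition muN (N : nat) (Y : set R[i]) : R :=
  \sum_(k < D N | lam k \in Y) xi k ^+ 2.

Definition mun (Y : set R[i]) : R := lim (muN N Y @[N --> U]).

Definition stripI (r e : R) : set R[i] :=
  [set l | square l /\ `|complex.Re l - r| < e].
Definition stripJ (r e : R) : set R[i] :=
  [set l | square l /\ `|complex.Im l - r| < e].

Definition nice (r : R) :=
  - M <= r <= M /\
  forall d : R, 0 < d -> exists2 e : R, 0 < e &
    mun (stripI r e) < d /\ mun (stripJ r e) < d.

Definition rect (r0 r1 r2 r3 : R) : set R[i] :=
  [set l | [/\ square l, r0 < complex.Re l < r1 & r2 < complex.Im l < r3]].

Definition Sqstar (NI : set R) : set (set R[i]) :=
  [set Y | exists r0 r1 r2 r3,
     [/\ NI r0, NI r1, NI r2 & NI r3] /\ Y = rect r0 r1 r2 r3].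

Record refinement := Refinement {
  NI : set R;
  Sq : nat -> set (set R[i]);
  NI_countable : countable NI;
  NI_nice : NI `<=` nice;
  NI_dense : [set r | - M <= r <= M] `<=` closure NI;
  NI_ends : NI (- M) /\ NI M;
  Sq_sub : forall n, Sq n `<=` Sqstar NI;
  Sq_finite : forall n, finite_set (Sq n);
  Sq_disjoint : forall n Y Z, Sq n Y -> Sq n Z -> Y <> Z -> Y `&` Z = set0;
  Sq_cover : forall n, \bigcup_(Y in Sq n) closure Y = square;
  Sq_fine : forall Y m, Sqstar NI Y -> exists n, (m < n)%N /\
    exists2 Z : set (set R[i]), Z `<=` Sq n &
      closure Y = \bigcup_(Y' in Z) closure Y';
  Sq_refine : forall n m Y, (n < m)%N -> Sq n Y ->
    exists2 Z : set (set R[i]), Z `<=` Sq m &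
      closure Y = \bigcup_(Y' in Z) closure Y';
  Sq_small : forall n Y, Sq n Y -> exists r0 r1 r2 r3,
    [/\ [/\ NI r0, NI r1, NI r2 & NI r3], Y = rect r0 r1 r2 r3,
        0 < r1 - r0 < 2 * M / n.+1%:R & 0 < r3 - r2 < 2 * M / n.+1%:R] }.

Section measure.
Variable P : refinement.

Definition mustar_int (Y : set R[i]) : \bar R :=
  ereal_inf [set (\sum_(0 <= i <oo) (mun (Z i))%:E)%E | Z in
    [set Z : nat -> set R[i] |
       (forall i, Sqstar (NI P) (Z i)) /\ Y `<=` \bigcup_i Z i]].

Definition mustar (Y : set R[i]) : \bar R := mustar_int (Y `&` interior square).

(* mu is the restriction of mustar to the Caratheodory measurable sets, so it is
   given by the same function; it is applied below to open rectangles only,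
   which are Borel sets. *)
Definition mu (Y : set R[i]) : \bar R := mustar Y.

End measure.

Definition norm_sigma (f : R[i] -> R[i]) : R :=
  sup [set cabs (f l) | l in sigmaA E].

(* The bound makes theta f depend only on the restriction of f to S. *)
Definition generalized_distribution (theta : (R[i] -> R[i]) -> R[i]) :=
  (forall a f g, CS f -> CS g ->
     theta (fun x => a * f x + g x) = a^* * theta f + theta g) /\
  exists K : nat, forall f, CS f -> cabs (theta f) <= K%:R * norm_sigma f.

Definition set_function (Y : set R[i]) (f : R[i] -> R[i]) :=
  [/\ CS f, forall x, square x -> cabs (f x) <= 1 &
      forall x, (square `\` Y) x -> f x = 0].

(* strip e is the e-neighbourhood of the line. *)
Definition very_good (theta : (R[i] -> R[i]) -> R[i]) (strip : R -> set R[i]) :=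
  (forall d : R, 0 < d -> exists2 e : R, 0 < e &
     forall f, set_function (strip e) f -> cabs (theta f) < d) /\
  (forall d : R, 0 < d -> exists2 e : R, 0 < e & mun (strip e) < d).

Definition very_good_grid (theta : (R[i] -> R[i]) -> R[i])
    (r : nat -> nat -> R) :=
  [/\ forall n i, (i < 2 ^ (n + 2) + 1)%N -> - M <= r n i <= M,
      forall n i, (i < 2 ^ (n + 2))%N ->
        r n i < r n i.+1 /\ r n i.+1 - r n i < 2 * M / n.+1%:R,
      forall n i, (i < 2 ^ (n + 2) + 1)%N ->
        very_good theta (stripI (r n i)) /\ very_good theta (stripJ (r n i)),
      r 0%N 0%N = - M /\ r 0%N 4%N = M &
      forall n i, (i < 2 ^ (n + 2) + 1)%N ->
        exists2 j, (j < 2 ^ (n.+1 + 2) + 1)%N & r n i = r n.+1 j].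

Section grid.
Variables (P : refinement) (theta : (R[i] -> R[i]) -> R[i]).
Variable r : nat -> nat -> R.

Definition cell (n i j : nat) : set R[i] :=
  rect (r n i) (r n i.+1) (r n j) (r n j.+1).

Definition grid_nbhd (n : nat) (e : R) : set R[i] :=
  \bigcup_(i in [set i | (i < 2 ^ (n + 2) + 1)%N])
    (stripI (r n i) e `|` stripJ (r n i) e).

Definition grid_small (n : nat) (e : R) :=
  forall j, (j < 2 ^ (n + 2))%N -> r n j + e < r n j.+1 - e.

Definition very_nice (n : nat) (e : R) :=
  forall i, (i < 2 ^ (n + 2))%N ->
    (nice (r n i + e) \/ ~ (- M <= r n i + e <= M)) /\
    (nice (r n i - e) \/ ~ (- M <= r n i - e <= M)).

(* z is the limit of theta(f_e) as e -> 0, for all choices of the f_e. *)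
Definition is_theta_cell (n i j : nat) (z : R[i]) :=
  forall d : R, 0 < d -> exists2 e0 : R, 0 < e0 & forall e, 0 < e < e0 ->
    forall f, set_function (cell n i j) f ->
      (forall x, r n i + e < complex.Re x < r n i.+1 - e ->
                 r n j + e < complex.Im x < r n j.+1 - e -> f x = 1) ->
      cabs (theta f - z) < d.

Definition theta_cell (n i j : nat) : R[i] := xget 0 (is_theta_cell n i j).

Definition good_delta (N n : nat) : R :=
  (* the inf of a finite set, i.e. its minimum *)
  inf [set d | exists i j, [/\ (i < 2 ^ (n + 2))%N, (j < 2 ^ (n + 2))%N,
                 (0 < mu P (cell n i j))%E & d = muN N (cell n i j)]]
  / 2 ^+ (3 * (n + 2)).

(* n and e stand for n(N) and epsilon(N). Since grid_nbhd n e is only considered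
   for e small with respect to the grid, this is part of the condition. *)
Definition good_at (N n : nat) (e : R) :=
  let d := good_delta N n in
  [/\ grid_small n e,
      forall f, set_function (grid_nbhd n e) f -> cabs (theta f) < d,
      \sum_(k < D N | lam k \in grid_nbhd n e) xi k ^+ 2 < d &
      forall i j, (i < 2 ^ (n + 2))%N -> (j < 2 ^ (n + 2))%N ->
        (`|(muN N (cell n i j))%:E - mu P (cell n i j)| < d%:E)%E].

(* theta-goodness with the exceptional set U(theta, n, epsilon) equal to V. *)
Definition theta_good (V : set nat) (n : nat -> nat) (e : nat -> R) :=
  [/\ forall N, 0 < e N,
      forall m, (0 < m)%N -> U [set N | (m < n N)%N /\ e N < m%:R^-1],
      U V /\ (forall N, V N -> (0 < n N)%N -> good_at N (n N) (e N)) &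
      forall N, very_nice (n N) (e N)].

Definition uN_theta (n : nat -> nat) (N : nat) : H :=
  let m := n N in
  \sum_(i < 2 ^ (m + 2)) \sum_(j < 2 ^ (m + 2) | mu P (cell m i j) != 0%E)
    \sum_(k < D N | lam k \in cell m i j)
      ((xi k)%:C%C * theta_cell m i j / (muN N (cell m i j))%:C%C)
        *: apu X k.

End grid.

Definition FN (f : R[i] -> R[i]) (N : nat) : H :=
  \sum_(k < D N) ((xi k)%:C%C * f (lam k)) *: apu X k.

End model.

Section spaces.
Variables (R : realType) (H : completeNormedModType R[i]).
Variables (ip : inner_product H) (E : cyclic_operator ip).
Variables (X : finite_models E) (U : set_system nat) (FU : UltraFilter U).

Local Notation D := (apD X).
Local Notation lam := (apl X).

Definition Hu := ultraproduct FU (fun N => set_type (HN E N)).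

(* Component in H_N of a chosen representative of v. *)
Definition component (v : Hu) (N : nat) : H := \val (ultra_repr v N).

Definition HN_zero (N : nat) : set_type (HN E N) :=
  SigSub (mem_set (@span0 R H [set x | exists i j,
    [/\ (i <= N)%N, (j <= N)%N & x = word E i j]])).

(* The element of H^u with components v N; any N with v N outside of H_N gets
   the dummy component 0. *)
Definition Hu_of (v : nat -> H) : Hu :=
  ultra_class FU (fun N => insubd (HN_zero N) (v N)).

Definition Hu_sub (v w : Hu) : Hu :=
  Hu_of (fun N => component v N - component w N).

Definition ipu (v w : Hu) : ultrapower FU R[i] :=
  ultra_class FU (fun N => ip (component v N) (component w N)).

(* a^N_k, the coordinate of v_N on the vector u_N(k) of the orthonormal basis. *)
Definition coef (v : Hu) (N : nat) (k : 'I_(D N)) : R[i] :=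
  ip (apu X k) (component v N).

Definition Fu (f : R[i] -> R[i]) : Hu := Hu_of (FN X f).

Definition u_theta (P : refinement X U) (theta : (R[i] -> R[i]) -> R[i])
    (r : nat -> nat -> R) (n : nat -> nat) : Hu :=
  Hu_of (uN_theta P theta r n).

(* The distance from z to sigma(A), a nonempty set. *)
Definition dist_sigma (z : R[i]) : R :=
  inf [set cabs (z - l) | l in sigmaA E].

Section zero_norm.
Variable P : refinement X U.

Definition norm0 (v : Hu) : ultrapower FU R :=
  ultra_class FU (fun N => \sum_(k < D N) xi k * cabs (coef v k)).

Definition rest (n : nat) (Y : set (set R[i])) : set R[i] :=
  \bigcup_(Z in Sq P n `\` Y) closure Z.

(* The infimum of dist_sigma over rest n Y is positive, or rest n Y is empty. *)
Definition good (n : nat) (Y : set (set R[i])) :=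
  exists2 d : R, 0 < d & forall z, rest n Y z -> d <= dist_sigma z.

Definition zero_good (v : Hu) :=
  forall n Y, Y `<=` Sq P n -> good n Y ->
    infinitesimal (ultra_class FU
      (fun N => \sum_(k < D N | lam k \in rest n Y) xi k * cabs (coef v k))).

Definition Hm0 : set Hu :=
  [set v | zero_good v /\ nat_bounded (norm0 v)].

Definition sim0 (v w : Hu) := infinitesimal (norm0 (Hu_sub v w)).

Definition class0 (v : Hu) : set Hu := [set w | Hm0 w /\ sim0 v w].

End zero_norm.

(* In a field of MathComp 0^-1 = 0, and the sup of the empty set is 0. *)
Definition normY_inf (Y : set R[i]) (v : Hu) (N : nat) : R :=
  sup [set (xi k)^-1 * cabs (coef v k) | k in [set k : 'I_(D N) | Y (lam k)]].

Definition sigma_nbhd (e : R) : set R[i] := [set z | dist_sigma z <= e].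

Definition norm_inf_eps (v : Hu) (e : R) : \bar R :=
  let s := normY_inf (sigma_nbhd e) v in
  if `[< cvg (s @ U) >] then (lim (s @ U))%:E else +oo%E.

Definition norm_inf (v : Hu) : \bar R :=
  if `[< exists (p : nat) (Z : set nat), U Z /\
          forall N, Z N -> forall k : 'I_(D N),
            cabs (coef v k) * (xi k)^-1 < p%:R >]
  then lim (norm_inf_eps v e @[e --> 0^'+]) else +oo%E.

Definition Hminf : set Hu := [set v | (norm_inf v < +oo)%E].

Definition sim_inf (v w : Hu) := norm_inf (Hu_sub v w) = 0%E.

Definition class_inf (v : Hu) : set Hu := [set w | Hminf w /\ sim_inf v w].

(* The pairing has values in C together with infinity, rendered as None. *)
Definition pairing (V W : set Hu) : option R[i] :=
  let L := [set q : R[i] | forall v w, V v -> W w ->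
              infinitely_close (ipu v w) q] in
  if `[< L !=set0 >] then Some (xget 0 L) else None.

End spaces.

(* Main.v *)
Require Import Defs.
From HB Require Import structures.
From mathcomp Require Import all_boot all_order all_algebra.
From mathcomp Require Import all_classical all_reals all_analysis.
From mathcomp Require Import complex.
From mathcomp Require Import lra ring.
Import Order.TTheory GRing.Theory Num.Theory.
Import numFieldNormedType.Exports.
Local Open Scope classical_set_scope.
Local Open Scope ring_scope.

(** At level N the pairing of F_N(f) with u_N(theta) is the sum over the cells B
    of theta(B, 1) times the conjugate of the mu_N-average of f on B
    (ip_FN_uN_theta). As f is almost constant on small cells, this is a Riemann
    sum for theta(f), in which theta is treated as a conjugate-linear measure
    with value theta(B, 1) on B. Three facts make this precise.

    The total variation of theta on the cells is bounded by the constant K of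
    theta (sum_theta_cell_le): test theta on a combination of plateau functions
    of the cells with unimodular coefficients. Since theta is small on functions
    supported near the grid lines (theta_grid_small), theta(f) differs from its
    Riemann sums by at most K times the oscillation of f on the cells
    (theta_step_approx).

    Cells on which mu vanishes are omitted from u_N(theta), and theta vanishes
    on them: a cell with theta(B, 1) <> 0 meets the spectrum of A
    (theta_cell_spectrum), and then mu(B) > 0 (mu_spectrum_gt0). For the latter,
    let l be a spectral point in B. Since A is normal, A - l is not bounded below
    (notin_spectrum), so by cyclicity there is an approximate eigenvector
    P(A, A^* ) phi. It lies in H_N for large N with coordinates
    P(lam_k, conj lam_k) xi_k (ip_apu_word), which forces a fixed part of the mass
    of mu_N to lie near l, uniformly in N (muN_spectrum); compactness transfers
    this to the outer measure.

    Finally, the pairing does not depend on the representatives. All xi_k are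
    positive (xi_gt0), so changing u(theta) by a vector of infinitesimal norm 0
    is harmless against vectors with bounded coordinates relative to xi. Changing
    F(f) by a vector whose norm at infinity is 0 is harmless because u(theta) is
    concentrated near the spectrum, where that norm is measured
    (pairing_close). *)

Set Implicit Arguments.
Unset Strict Implicit.
Unset Printing Implicit Defensive.

Local Notation span := Defs.span.

(** * The complex plane *)

Section complex_plane.
Variable R : realType.
Implicit Types (z w : R[i]) (A : set R[i]).

Lemma cabsE z : `|z| = (cabs z)%:C%C.
Proof. by []. Qed.

Lemma real_complexD (x y : R) : (x + y)%:C%C = x%:C%C + y%:C%C.
Proof. exact: rmorphD. Qed.

Lemma real_complexB (x y : R) : (x - y)%:C%C = x%:C%C - y%:C%C.
Proof. exact: rmorphB. Qed.

Lemma real_complexM (x y : R) : (x * y)%:C%C = x%:C%C * y%:C%C.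
Proof. exact: rmorphM. Qed.

Lemma real_complexX (x : R) k : (x ^+ k)%:C%C = x%:C%C ^+ k.
Proof. exact: rmorphXn. Qed.

Lemma real_complex_sum (I : Type) (s : seq I) (Q : pred I) (F : I -> R) :
  (\sum_(i <- s | Q i) F i)%:C%C = \sum_(i <- s | Q i) (F i)%:C%C.
Proof. exact: (rmorph_sum (real_complex R)). Qed.

Lemma real_complex_eq0 (x : R) : (x%:C%C == 0 :> R[i]) = (x == 0).
Proof. exact: (inj_eq (@complexI R) x 0). Qed.

Lemma real_complexJ (x : R) : x%:C%C^* = x%:C%C.
Proof. exact: conjc_real. Qed.

Lemma cabs_ge0 z : 0 <= cabs z.
Proof. by rewrite -lecR; exact: (normr_ge0 z). Qed.

Lemma cabs_conj z : cabs z^* = cabs z.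
Proof. by apply: complexI; rewrite -!cabsE norm_conjC. Qed.

Lemma cabs_real (x : R) : cabs x%:C%C = `|x|.
Proof. by rewrite /= expr0n addr0 sqrtr_sqr. Qed.

Lemma cabs_eq0 z : (cabs z == 0) = (z == 0).
Proof. by rewrite -[RHS]normr_eq0 cabsE -(inj_eq (@complexI R)). Qed.

Lemma cabs_sum (I : Type) (s : seq I) (Q : pred I) (F : I -> R[i]) :
  cabs (\sum_(i <- s | Q i) F i) <= \sum_(i <- s | Q i) cabs (F i).
Proof.
elim/big_rec2: _ => [|i x z _ le_zx].
  by rewrite ComplexField.Normc.normc0.
by rewrite (le_trans (le_normcD _ _))// lerD2l.
Qed.

Lemma cabs_distC z w : cabs (z - w) = cabs (w - z).
Proof. by rewrite -normcN opprB. Qed.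

Lemma cabs_lipschitz z w : `|cabs z - cabs w| <= cabs (z - w).
Proof.
have := le_normcD (z - w) w; have := le_normcD (w - z) z.
rewrite !subrK (cabs_distC w) ler_norml => h1 h2.
by apply/andP; split; lra.
Qed.

Lemma cabsX z k : cabs (z ^+ k) = cabs z ^+ k.
Proof.
elim: k => [|k IH]; first by rewrite !expr0 ComplexField.Normc.normc1.
by rewrite !exprS ComplexField.Normc.normcM IH.
Qed.

Lemma le_Re_cabs z : `|complex.Re z| <= cabs z.
Proof. by rewrite -lecR -cabsE normc_ge_Re. Qed.

Lemma le_Im_cabs z : `|complex.Im z| <= cabs z.
Proof.
case: z => a b /=; rewrite -sqrtr_sqr ler_wsqrtr// lerDr.
exact: sqr_ge0.
Qed.

Lemma le_cabs_ReIm z : cabs z <= `|complex.Re z| + `|complex.Im z|.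
Proof.
rewrite [z in cabs z]complexE (le_trans (le_normcD _ _))//.
rewrite ComplexField.Normc.normcM cabs_real lerD2l.
by rewrite cabs_real /= expr0n expr1n add0r sqrtr1 mul1r.
Qed.

Lemma ReB z w : complex.Re (z - w) = complex.Re z - complex.Re w.
Proof. by case: z w => a b [c d]. Qed.

Lemma ImB z w : complex.Im (z - w) = complex.Im z - complex.Im w.
Proof. by case: z w => a b [c d]. Qed.

Lemma gt0_complexP (e : R[i]) : 0 < e -> exists2 d : R, 0 < d & e = d%:C%C.
Proof.
case: e => a b; rewrite ltcE /= => /andP[/eqP -> a0]; by exists a.
Qed.

(** Topologically R[i] is a normed module over itself, so its neighbourhoods
    are indexed by positive elements of R[i]; this is the bridge to real
    epsilons. *)
Lemma within_cabsP A (f : R[i] -> R[i]) :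
  {within A, continuous f} <->
  forall x, A x -> forall e : R, 0 < e -> exists2 d : R, 0 < d &
    forall y, A y -> cabs (x - y) < d -> cabs (f x - f y) < e.
Proof.
rewrite subspace_continuousP; split=> cf x Ax.
  move=> e e0; have /cvgrPdist_lt/(_ e%:C%C) := cf x Ax.
  rewrite ltcR => /(_ e0)/nbhs_normP[d /gt0_complexP[d' d'0 ->]] dP.
  exists d' => // y Ay xy; have := dP y; rewrite /= cabsE ltcR => /(_ xy Ay).
  by rewrite /= cabsE ltcR.
apply/cvgrPdist_lt => _ /gt0_complexP[e e0 ->].
have [d d0 dP] := cf x Ax e e0.
apply/nbhs_normP; exists d%:C%C; first by rewrite /= ltcR.
by move=> y /=; rewrite !cabsE !ltcR => xy Ay; exact: dP.
Qed.

Lemma Re_continuous : continuous (@complex.Re R).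
Proof.
move=> z; apply/(@cvgrPdist_lt _ _ _ _ (nbhs_filter z)) => e e0.
apply/nbhs_normP.
exists e%:C%C; first by rewrite /= ltcR.
move=> w /=; rewrite cabsE ltcR -ReB; apply: le_lt_trans.
exact: le_Re_cabs.
Qed.

Lemma Im_continuous : continuous (@complex.Im R).
Proof.
move=> z; apply/(@cvgrPdist_lt _ _ _ _ (nbhs_filter z)) => e e0.
apply/nbhs_normP.
exists e%:C%C; first by rewrite /= ltcR.
move=> w /=; rewrite cabsE ltcR -ImB; apply: le_lt_trans.
exact: le_Im_cabs.
Qed.

(** The homeomorphic image of a product of two segments of R. *)
Lemma closed_rectangle_compact (a b c d : R) :
  compact [set z : R[i] | a <= complex.Re z <= b /\ c <= complex.Im z <= d].
Proof.
pose g (p : R * R) : R[i] := (p.1 +i* p.2)%C.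
rewrite (_ : mkset _ = g @` (`[a, b] `*` `[c, d])); last first.
  apply/seteqP; split=> [[x y] /= [xab ycd]|z [[x y] /=]].
    by exists (x, y) => //=; rewrite !in_itv.
  by rewrite !in_itv /= => -[? ?] <-.
apply: continuous_compact; last by apply: compact_setX; exact: segment_compact.
apply: continuous_subspaceT => p.
apply/cvgrPdist_lt => _ /gt0_complexP[e e0 ->].
have e20 : 0 < e / 2 by rewrite divr_gt0.
exists ([set x | `|p.1 - x| < e / 2], [set y | `|p.2 - y| < e / 2]) => /=.
  by split; apply/nbhs_normP; exists (e / 2).
move=> [x y] /= [px py]; rewrite cabsE ltcR (le_lt_trans (le_cabs_ReIm _))//.
by rewrite ReB ImB /= (splitr e) ltrD.
Qed.

(** Heine-Cantor, through the near-covering form of compactness: the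
    radius d is the parameter that tends to 0. *)
Lemma compact_cabs_unif A (f : R[i] -> R[i]) : compact A ->
  {within A, continuous f} -> forall e : R, 0 < e -> exists2 d : R, 0 < d &
    forall x y, A x -> A y -> cabs (x - y) < d -> cabs (f x - f y) < e.
Proof.
move=> /compact_near_coveringP/near_covering_withinP cA /within_cabsP cf e e0.
have e20 : 0 < e / 2 by rewrite divr_gt0.
have := cA R (0^'+) (fun d x => forall y, A y -> cabs (x - y) < d ->
  cabs (f x - f y) < e).
case.
  move=> x Ax; have [d d0 dP] := cf x Ax _ e20.
  have d20 : 0 < d / 2 by rewrite divr_gt0.
  exists ([set z | `|x - z| < (d / 2)%:C%C], [set r | r < d / 2]) => /=.
    split; first by apply/nbhs_normP; exists (d / 2)%:C%C; rewrite /= ?ltcR.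
    exact: nbhs_right_lt.
  move=> [z r] /= [+ rd] Az y Ay zy; rewrite cabsE ltcR => xz.
  rewrite -(subrKA (f x)) (le_lt_trans (le_normcD _ _))// (splitr e).
  rewrite ltrD//.
    rewrite cabs_distC dP// (lt_trans xz)// ltr_pdivrMr// ltr_pMr// ltr1n//.
  apply: dP => //; rewrite -(subrKA z) (le_lt_trans (le_normcD _ _))//.
  by rewrite (splitr d) ltrD// (lt_trans zy).
move=> d /= d0 /(_ (d / 2)) P.
exists (d / 2); first by rewrite divr_gt0.
move=> x y Ax Ay xy; apply: P => //=; last by rewrite divr_gt0.
by rewrite sub0r normrN gtr0_norm ?divr_gt0// ltr_pdivrMr// ltr_pMr// ltr1n.
Qed.

Lemma compact_cabs_bounded A (f : R[i] -> R[i]) : compact A ->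
  {within A, continuous f} -> exists2 C : R, 0 < C &
    forall x, A x -> cabs (f x) <= C.
Proof.
move=> cA cf.
have [->|A0] := eqVneq A set0; first by exists 1.
have An0 : A !=set0 by apply/set0P.
have [|c cAc cP] := @compact_EVT_max _ _ (fun x => cabs (f x)) _ An0 cA.
  apply/subspace_continuousP => x Ax; apply/cvgrPdist_lt => e e0.
  have [d d0 dP] := (within_cabsP A f).1 cf x Ax e e0.
  apply/nbhs_normP; exists d%:C%C; first by rewrite /= ltcR.
  move=> y /=; rewrite cabsE ltcR => xy Ay; apply: le_lt_trans (dP y Ay xy).
  exact: cabs_lipschitz.
exists (cabs (f c) + 1); first by rewrite ltr_wpDl ?cabs_ge0.
by move=> x Ax; rewrite (le_trans (cP x _)) ?inE// lerDl.
Qed.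

End complex_plane.

(** The image of U clusters in [a, b] by compactness, and an ultrafilter
    converges to each of its cluster points. *)
Lemma ultra_bounded_cvg (R : realType) (U : set_system nat) (FU : UltraFilter U)
    (s : nat -> R) (a b : R) :
  U [set N | a <= s N <= b] ->
  cvg (s N @[N --> U]) /\ a <= lim (s N @[N --> U]) <= b.
Proof.
move=> Us.
have PF : ProperFilter (s N @[N --> U]) by exact: fmap_proper_filter.
have [|p [pab pc]] := @segment_compact R a b _ PF.
  suff: U (s @^-1` `[a, b]) by [].
  by apply: filterS Us => N /= sab; rewrite in_itv.
have sp : s N @[N --> U] --> p.
  move=> A nA; have [//|UnA] := in_ultra_setVsetC (s @^-1` A) FU.
  have [x [/= nAx Ax]] := pc (~` A) A UnA nA.
  by [].
have lp : lim (s N @[N --> U]) = p by apply: cvg_lim.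
by split; [exact: cvgP sp|rewrite lp; move: pab; rewrite /= in_itv].
Qed.

(** * Inner products and projections onto finite spans *)

Section inner_product_theory.
Variables (R : realType) (H : completeNormedModType R[i]).
Variable ip : inner_product H.
Implicit Types (x y z : H) (a : R[i]) (B : set H).

Lemma ipDr x y z : ip x (y + z) = ip x y + ip x z.
Proof. by rewrite -{1}[y]scale1r ip_linear mul1r. Qed.

Lemma ip0r x : ip x 0 = 0.
Proof. by apply: (addrI (ip x 0)); rewrite -ipDr !addr0. Qed.

Lemma ipZr x a y : ip x (a *: y) = a * ip x y.
Proof. by rewrite -[a *: y]addr0 ip_linear ip0r addr0. Qed.

Lemma ipBr x y z : ip x (y - z) = ip x y - ip x z.
Proof. by rewrite ipDr -scaleN1r ipZr mulN1r. Qed.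

Lemma ip_sumr x (I : Type) (s : seq I) (Q : pred I) (F : I -> H) :
  ip x (\sum_(i <- s | Q i) F i) = \sum_(i <- s | Q i) ip x (F i).
Proof. exact: (big_morph _ (ipDr x) (ip0r x)). Qed.

Lemma ipDl x y z : ip (x + y) z = ip x z + ip y z.
Proof. by rewrite !(ip_conj ip z) ipDr rmorphD. Qed.

Lemma ip0l x : ip 0 x = 0.
Proof. by rewrite ip_conj ip0r rmorph0. Qed.

Lemma ipZl x a y : ip (a *: x) y = a^* * ip x y.
Proof. by rewrite !(ip_conj ip y) ipZr rmorphM. Qed.

Lemma ipBl x y z : ip (x - y) z = ip x z - ip y z.
Proof. by rewrite !(ip_conj ip z) ipBr rmorphB. Qed.

Lemma ip_suml x (I : Type) (s : seq I) (Q : pred I) (F : I -> H) :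
  ip (\sum_(i <- s | Q i) F i) x = \sum_(i <- s | Q i) ip (F i) x.
Proof. exact: (big_morph _ (fun y z => ipDl y z x) (ip0l x)). Qed.

Lemma ip_inj x y : (forall z, ip x z = ip y z) -> x = y.
Proof.
move=> xy; apply/eqP; rewrite -subr_eq0 -normr_eq0 -sqrf_eq0.
by rewrite (ip_norm ip) ipBl xy subrr.
Qed.

(** The norm of H takes its values in R[i]; estimates are made in R. *)
Definition hnorm x : R := complex.Re `|x|.

Lemma hnormE x : `|x| = (hnorm x)%:C%C.
Proof. by rewrite RRe_real// ger0_real. Qed.

Lemma hnorm_ge0 x : 0 <= hnorm x.
Proof. by rewrite -lecR -hnormE; exact: normr_ge0. Qed.

Lemma le_hnormD x y : hnorm (x + y) <= hnorm x + hnorm y.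
Proof. by rewrite -lecR real_complexD -!hnormE ler_normD. Qed.

Lemma hnormZ a x : hnorm (a *: x) = cabs a * hnorm x.
Proof. by apply: complexI; rewrite real_complexM -!hnormE normrZ. Qed.

Lemma hnorm_opp x : hnorm (- x) = hnorm x.
Proof. by rewrite /hnorm normrN. Qed.

Lemma hnorm_sqr x : (hnorm x ^+ 2)%:C%C = ip x x.
Proof. by rewrite real_complexX -hnormE (ip_norm ip). Qed.

Lemma hnorm_eq0 x : hnorm x = 0 -> x = 0.
Proof. by move=> x0; apply: normr0_eq0; rewrite hnormE x0. Qed.

Lemma hnorm_inj x y : ip x x = ip y y -> hnorm x = hnorm y.
Proof.
move=> xy; apply/eqP; rewrite -(@eqrXn2 _ 2)// ?hnorm_ge0//; apply/eqP.
by apply: complexI; rewrite !hnorm_sqr.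
Qed.

Lemma hnormB_sqr x y :
  ((hnorm (x - y)) ^+ 2)%:C%C = ip x x - ip x y - ip y x + ip y y.
Proof. by rewrite hnorm_sqr ipBr !ipBl; ring. Qed.

Lemma span_lin B a x y : span B x -> span B y -> span B (a *: x + y).
Proof.
case=> m1 [c1 [y1 [By1 ->]]] [m2 [c2 [y2 [By2 ->]]]].
exists (m1 + m2)%N, (fun i => match fintype.split i with inl j => a * c1 j
  | inr j => c2 j end), (fun i => match fintype.split i with inl j => y1 j
  | inr j => y2 j end); split.
  by move=> i; case: (fintype.split i).
rewrite big_split_ord /= scaler_sumr; congr (_ + _); apply: eq_bigr => i _.
  by rewrite (unsplitK (inl i)) scalerA.
by rewrite (unsplitK (inr i)).
Qed.

Lemma span_gen B : B `<=` span B.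
Proof.
move=> x Bx; exists 1%N, (fun=> 1), (fun=> x); split => //.
by rewrite big_ord1 scale1r.
Qed.

Lemma span_min B (Q : set H) : Q 0 ->
  (forall a x y, Q x -> Q y -> Q (a *: x + y)) -> B `<=` Q -> span B `<=` Q.
Proof.
move=> Q0 QL BQ _ [m [c [y [By ->]]]].
elim/big_rec: _ => // i x _ Qx; apply: QL => //; exact: BQ.
Qed.

Lemma spanD B x y : span B x -> span B y -> span B (x + y).
Proof. by move=> Bx By; rewrite -[x]scale1r; exact: span_lin. Qed.

Lemma spanZ B a x : span B x -> span B (a *: x).
Proof.
by move=> Bx; rewrite -[_ *: _]addr0; apply: span_lin => //; exact: span0.
Qed.

Lemma spanB B x y : span B x -> span B y -> span B (x - y).
Proof.
by move=> Bx By; rewrite -scaleN1r; apply: spanD => //; exact: spanZ.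
Qed.

Lemma span_sum B (I : Type) (s : seq I) (Q : pred I) (F : I -> H) :
  (forall i, Q i -> span B (F i)) -> span B (\sum_(i <- s | Q i) F i).
Proof.
move=> BF; elim/big_rec: _ => [|i x Qi Bx]; first exact: span0.
by apply: spanD => //; exact: BF.
Qed.

Lemma span_mono B B' : B `<=` B' -> span B `<=` span B'.
Proof.
move=> BB'; apply: span_min; [exact: span0|exact: span_lin|].
by move=> x /BB'; exact: span_gen.
Qed.

Lemma orth_span B x : (forall y, B y -> ip y x = 0) ->
  forall y, span B y -> ip y x = 0.
Proof.
move=> Bx; apply: span_min => //; first exact: ip0l.
by move=> a y z yx zx; rewrite ipDl ipZl yx zx mulr0 addr0.
Qed.

(** Gram-Schmidt, one vector at a time. *)
Lemma span_projection (s : seq H) x : exists2 p, span [set` s] p &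
  forall y, span [set` s] y -> ip y (x - p) = 0.
Proof.
suff [p sp pP] : exists2 p, span [set` s] p &
    forall y, y \in s -> ip y (x - p) = 0.
  by exists p => //; exact: orth_span.
elim: s x => [|y s IH] x; first by exists 0 => //; exact: span0.
have sS : span [set` s] `<=` span [set` y :: s].
  by apply: span_mono => z /= zs; rewrite inE zs orbT.
have [p ps pP] := IH x; have [p0 p0s p0P] := IH y.
have p0P' z : span [set` s] z -> ip z (y - p0) = 0 by exact: orth_span.
have sy : span [set` y :: s] (y - p0).
  by apply: spanB; [apply: span_gen; rewrite /= inE eqxx|exact: sS].
have [y0|y0] := eqVneq (ip (y - p0) (y - p0)) 0.
  exists p; first exact: sS.
  have -> : y = p0.
    apply/eqP; rewrite -subr_eq0 -normr_eq0 -sqrf_eq0.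
    by rewrite (ip_norm ip) y0.
  move=> z; rewrite inE => /predU1P[->|/pP//].
  exact: (orth_span pP).
pose c := ip (y - p0) (x - p) / ip (y - p0) (y - p0).
have E : x - (p + c *: (y - p0)) = x - p - c *: (y - p0).
  by rewrite opprD addrA.
exists (p + c *: (y - p0)); first by apply: spanD; [exact: sS|exact: spanZ].
have zP z : z \in s -> ip z (x - (p + c *: (y - p0))) = 0.
  by move=> zs; rewrite E ipBr pP// ipZr p0P// mulr0 subr0.
move=> z; rewrite inE => /predU1P[->|/zP//].
have yE : y = (y - p0) + p0 by rewrite subrK.
have -> u : ip y u = ip (y - p0) u + ip p0 u by rewrite -ipDl subrK.
rewrite (orth_span zP p0s) addr0.
by rewrite E ipBr ipZr divfK// subrr.
Qed.

End inner_product_theory.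

(** * Normal operators bounded below are invertible *)

(** T has adjoint T' and commutes with it, c |x| <= |T x| <= L |x|. Expanding
    |x - S x / L^2|^2 for S = T' T = T T' shows that I - S / L^2 is a strict
    contraction, with ratio kappa = sqrt(1 - (c / L)^2). The Richardson iteration
    x - (S x - y) / L^2 then converges to a solution of S x = y, so that S, and
    with it T, is onto. *)
Section normal_bounded_below.
Variables (R : realType) (H : completeNormedModType R[i]).
Variables (ip : inner_product H) (T T' : H -> H) (c L : R).
Hypothesis T_lin : linear T.
Hypothesis T'E : forall x y, ip (T' x) y = ip x (T y).
Hypothesis TT' : forall x, T (T' x) = T' (T x).
Hypotheses (c0 : 0 < c) (L0 : 0 < L).
Hypothesis T_bnd : forall x, c * hnorm x <= hnorm (T x).
Hypothesis T_cont : forall x, hnorm (T x) <= L * hnorm x.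
Implicit Types (x y z : H) (a : R[i]).

Let S x := T' (T x).

Let T'_lin : linear T'.
Proof.
by move=> a x y; apply: (@ip_inj _ _ ip) => z; rewrite !(T'E, ipDl, ipZl).
Qed.

Let S_lin : linear S.
Proof. by move=> a x y; rewrite /S T_lin T'_lin. Qed.

Let TB x y : T (x - y) = T x - T y.
Proof. by rewrite addrC -scaleN1r T_lin scaleN1r addrC. Qed.

Let SB x y : S (x - y) = S x - S y.
Proof. by rewrite addrC -scaleN1r S_lin scaleN1r addrC. Qed.

Let normT' x : hnorm (T' x) = hnorm (T x).
Proof. by apply: (@hnorm_inj _ _ ip); rewrite T'E TT' ip_conj T'E -ip_conj. Qed.

Let kappa : R := Num.sqrt (1 - (c / L) ^+ 2).

Let kappa_lt1 : kappa < 1.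
Proof.
rewrite -[X in _ < X]sqrtr1 ltr_sqrt ?ltr01// ltrBlDr ltrDl.
by rewrite exprn_gt0// divr_gt0.
Qed.

Let t : R := L ^- 2.

Let richardson_contraction x : hnorm (x - t%:C%C *: S x) <= kappa * hnorm x.
Proof.
have xSx : ip x (S x) = (hnorm (T x) ^+ 2)%:C%C.
  by rewrite ip_conj T'E -(hnorm_sqr ip) real_complexJ.
have Sxx : ip (S x) x = (hnorm (T x) ^+ 2)%:C%C.
  by rewrite T'E -(hnorm_sqr ip).
have SxSx : ip (S x) (S x) = (hnorm (T (T x)) ^+ 2)%:C%C.
  by rewrite -(hnorm_sqr ip) normT'.
have sq : hnorm (x - t%:C%C *: S x) ^+ 2 =
    hnorm x ^+ 2 - (t *+ 2) * hnorm (T x) ^+ 2 + t ^+ 2 * hnorm (T (T x)) ^+ 2.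
  apply: complexI; rewrite (hnormB_sqr ip) !(ipZl, ipZr) real_complexJ.
  rewrite xSx Sxx SxSx -(hnorm_sqr ip).
  move: (_ ^+ 2) (_ ^+ 2) (_ ^+ 2) => u v w.
  rewrite real_complexD real_complexB mulr2n expr2 !real_complexM real_complexD.
  by ring.
have le1 : hnorm (T (T x)) ^+ 2 <= L ^+ 2 * hnorm (T x) ^+ 2.
  by rewrite -exprMn lerXn2r ?nnegrE ?mulr_ge0 ?hnorm_ge0 ?(ltW L0)// T_cont.
have le2 : c ^+ 2 * hnorm x ^+ 2 <= hnorm (T x) ^+ 2.
  by rewrite -exprMn lerXn2r ?nnegrE ?mulr_ge0 ?hnorm_ge0 ?(ltW c0)// T_bnd.
have le3 : hnorm (x - t%:C%C *: S x) ^+ 2 <=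
    (1 - (c / L) ^+ 2) * hnorm x ^+ 2.
  have t0 : 0 < t by rewrite invr_gt0 exprn_gt0.
  have tL : t * L ^+ 2 = 1 by rewrite mulVf// expf_neq0// gt_eqF.
  have -> : (c / L) ^+ 2 = t * c ^+ 2 by rewrite exprMn exprVn mulrC.
  rewrite sq; move: le1 le2 t0 tL; set h1 := _ ^+ 2; set h2 := hnorm (T x) ^+ 2.
  set h3 := hnorm x ^+ 2; set L2 := L ^+ 2; set c2 := c ^+ 2.
  move=> le1 le2 t0 tL.
  have e1 : t ^+ 2 * h1 <= t * h2.
    rewrite expr2 -mulrA ler_pM2l// (le_trans (ler_wpM2l (ltW t0) le1))//.
    by rewrite mulrA tL mul1r.
  have e2 : t * (c2 * h3) <= t * h2 by rewrite ler_pM2l.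
  nra.
have k2 : 0 <= (1 - (c / L) ^+ 2) * hnorm x ^+ 2.
  by apply: le_trans le3; rewrite sqr_ge0.
have -> : kappa * hnorm x = Num.sqrt ((1 - (c / L) ^+ 2) * hnorm x ^+ 2).
  have [hx|hx] := eqVneq (hnorm x) 0.
    by rewrite hx expr0n !mulr0 sqrtr0.
  rewrite sqrtrM ?sqrtr_sqr ?ger0_norm ?hnorm_ge0//.
  by move: k2; rewrite pmulr_lge0// exprn_gt0// lt_neqAle eq_sym hx hnorm_ge0.
rewrite -[leLHS]ger0_norm ?hnorm_ge0// -sqrtr_sqr.
exact: ler_wsqrtr.
Qed.

Let T_inj x y : T x = T y -> x = y.
Proof.
move=> xy; apply/eqP; rewrite -subr_eq0; apply/eqP/hnorm_eq0/eqP.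
rewrite eq_le hnorm_ge0 andbT -(ler_pM2l c0) mulr0 (le_trans (T_bnd _))//.
by rewrite TB xy subrr /hnorm normr0.
Qed.

Let S_surj y : exists x, S x = y.
Proof.
(* The limit of the iteration is identified by |S u_k - y| = L^2 |d_k|. *)
pose u := fix u k := if k is k'.+1 then u k' - t%:C%C *: (S (u k') - y) else 0.
pose d k := u k.+1 - u k.
have k0 : 0 <= kappa by exact: sqrtr_ge0.
have dS k : d k.+1 = d k - t%:C%C *: S (d k).
  have swap (a b p r : H) : (a - p) - (b - r) = (a - b) - (p - r).
    by rewrite !opprB addrACA [RHS]addrACA [- p - b]addrC.
  rewrite {1}/d [u k.+2]/= -/(u k.+1) [in X in _ - X]/u /= -/u swap -scalerBr.
  by rewrite opprB addrA subrK -SB.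
have dle k : hnorm (d k) <= kappa ^+ k * hnorm (d 0%N).
  elim: k => [|k IH]; first by rewrite expr0 mul1r.
  by rewrite dS (le_trans (richardson_contraction _))// exprS -mulrA ler_wpM2l.
have ser_u : series d = u.
  apply/funext => k; rewrite /series /= telescope_sumr// /u subr0//.
have cvg_u : cvg (u k @[k --> \oo]).
  apply/cauchy_cvgP; rewrite -ser_u; apply/cauchy_seriesP.
  move=> _ /gt0_complexP[e e0 ->].
  have : cvgn (series (geometric (hnorm (d 0%N)) kappa)).
    by apply: is_cvg_geometric_series; rewrite ger0_norm.
  move=> /cauchy_cvgP/cauchy_seriesP/(_ e e0); apply: filterS => -[n m] /= le_e.
  rewrite hnormE ltcR (le_lt_trans _ le_e)//.
  rewrite (le_trans _ (ler_norm _))//; elim/big_rec2: _ => [|k a b _ le_ba].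
    by rewrite /hnorm normr0.
  by rewrite (le_trans (le_hnormD _ _))// lerD//= mulrC.
have /cvg_ex[x ux] := cvg_u; exists x.
apply/eqP; rewrite -subr_eq0; apply/eqP/hnorm_eq0/eqP.
rewrite eq_le hnorm_ge0 andbT.
apply/ler_addgt0Pr => e e0; rewrite add0r.
have L2 : 0 < L ^+ 2 by rewrite exprn_gt0.
pose e' := e / (L ^+ 2 * 3).
have e'0 : 0 < e' by rewrite divr_gt0// mulr_gt0.
have /cvgrPdist_lt/(_ e'%:C%C) := ux; rewrite ltcR => /(_ e'0)[N _ xu].
have S_cont z : hnorm (S z) <= L ^+ 2 * hnorm z.
  by rewrite normT' (le_trans (T_cont _))// expr2 -mulrA ler_pM2l.
have xN : hnorm (x - u N) < e' by rewrite -ltcR -hnormE; apply: xu => /=.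
have xN1 : hnorm (x - u N.+1) < e'.
  by rewrite -ltcR -hnormE; apply: xu => /=.
have dN : hnorm (d N) <= e' + e'.
  rewrite /d -(subrKA x) -(opprB x) addrC (le_trans (le_hnormD _ _))//.
  by rewrite hnorm_opp ltW// ltrD.
have -> : S x - y = S (x - u N) - (L ^+ 2)%:C%C *: d N.
  rewrite /d /= -/u addrAC subrr add0r scalerN opprK scalerA -real_complexM.
  by rewrite divff ?gt_eqF// scale1r SB addrA subrK.
rewrite (le_trans (le_hnormD _ _))// hnorm_opp hnormZ cabs_real.
rewrite ger0_norm ?(ltW L2)//.
rewrite (le_trans (lerD (S_cont _) (lexx _)))// -mulrDr.
have -> : e = L ^+ 2 * (e' + (e' + e')) by rewrite /e'; field; rewrite gt_eqF.
by rewrite ler_pM2l// lerD// ltW.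
Qed.

Lemma normal_bounded_below_inverse : exists B : {linear H -> H}, continuous B /\
  forall x, B (T x) = x /\ T (B x) = x.
Proof.
have Tsurj y : exists x, T x = y.
  by have [x <-] := S_surj y; exists (T' x); rewrite TT'.
pose B y := xget 0 [set x | T x = y].
have TB' y : T (B y) = y.
  have [x xy] := Tsurj y.
  exact: (@xgetPex _ 0 [set x | T x = y] (ex_intro _ x xy)).
have BT x : B (T x) = x by apply: T_inj; rewrite TB'.
have B_lin : linear B by move=> a x y; apply: T_inj; rewrite T_lin !TB'.
pose BL : {linear H -> H} := HB.pack B (GRing.isLinear.Build _ _ _ _ B B_lin).
exists BL; split=> //= y; apply/(@cvgrPdist_lt _ _ _ _ (nbhs_filter y)).
move=> _ /gt0_complexP[e e0 ->]; apply/nbhs_normP.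
have ce : 0 < c * e by rewrite mulr_gt0.
exists (c * e)%:C%C; first by rewrite /= ltcR.
move=> z /=; rewrite !hnormE !ltcR => yz.
rewrite -(ltr_pM2l c0) (le_lt_trans _ yz)// (le_trans (T_bnd _))//.
by rewrite TB !TB'.
Qed.

End normal_bounded_below.

(** * The operator A and its spectrum *)

Section cyclic_operator_theory.
Variables (R : realType) (H : completeNormedModType R[i]).
Variables (ip : inner_product H) (E : cyclic_operator ip).
Implicit Types (x y z : H) (a : R[i]).

Local Notation A := (opA E).
Local Notation As := (opAdj E).
Local Notation q := (opq E).
Local Notation rA := (rA E).

Lemma opA_lin a x y : A (a *: x + y) = a *: A x + A y.
Proof. by rewrite /opA linearP scalerDr !scalerA mulrC. Qed.

Lemma opA0 : A 0 = 0.
Proof. by rewrite /opA linear0 scaler0. Qed.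

Lemma opq_conj_mul : q^* * q = rA%:C%C.
Proof. by rewrite mulrC -normCK cabsE real_complexX. Qed.

Lemma opAB x y : A (x - y) = A x - A y.
Proof. by rewrite addrC -scaleN1r opA_lin scaleN1r addrC. Qed.

Lemma opAZ a x : A (a *: x) = a *: A x.
Proof. by rewrite -[a *: x]addr0 opA_lin opA0 addr0. Qed.

Lemma rA_gt0 : 0 < rA.
Proof. by rewrite exprn_gt0// lt_neqAle cabs_ge0 eq_sym cabs_eq0 opq_neq0. Qed.

Lemma rAC_neq0 : rA%:C%C != 0 :> R[i].
Proof. by rewrite real_complex_eq0 gt_eqF ?rA_gt0. Qed.

Lemma ip_opA x y : ip (A x) (A y) = rA%:C%C * ip x y.
Proof.
rewrite /opA ipZl ipZr mulrA opq_conj_mul.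
by have [_ _ ->] := opV_unitary E.
Qed.

Lemma opA_surj y : exists x, A x = y.
Proof.
have [_ VT _] := opV_unitary E.
have [x _ Vx] : (opV E @` setT) (q^-1 *: y) by rewrite VT.
by exists x; rewrite /opA Vx scalerA divff ?scale1r// opq_neq0.
Qed.

Lemma opAdjE x y : ip (As x) y = ip x (A y).
Proof. exact: opAdj_adjoint. Qed.

Lemma opAdj_lin a x y : As (a *: x + y) = a *: As x + As y.
Proof.
by apply: (@ip_inj _ _ ip) => z; rewrite !(opAdjE, ipDl, ipZl).
Qed.

Lemma opAdjB x y : As (x - y) = As x - As y.
Proof. by rewrite addrC -scaleN1r opAdj_lin scaleN1r addrC. Qed.

Lemma opAdjZ a x : As (a *: x) = a *: As x.
Proof.
have As0 : As 0 = 0 by rewrite -[X in As X](subrr (0 : H)) opAdjB subrr.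
by rewrite -[a *: x]addr0 opAdj_lin As0 addr0.
Qed.

Lemma opAdjK x : As (A x) = rA%:C%C *: x.
Proof.
apply: (@ip_inj _ _ ip) => z; rewrite opAdjE ip_opA ipZl; congr (_ * _).
by rewrite real_complexJ.
Qed.

Lemma opAK x : A (As x) = rA%:C%C *: x.
Proof.
by have [y <-] := opA_surj x; rewrite opAdjK /opA linearZ /= !scalerA mulrC.
Qed.

Lemma hnorm_opA x : hnorm (A x) = cabs q * hnorm x.
Proof.
rewrite /opA hnormZ; congr (_ * _); apply: (@hnorm_inj _ _ ip).
by have [_ _ ->] := opV_unitary E.
Qed.

(** A - l is normal, because A^* A = A A^* = r_A. *)
Lemma notin_spectrum (l : R[i]) (c : R) : 0 < c ->
  (forall x, c * hnorm x <= hnorm (A x - l *: x)) -> ~ sigmaA E l.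
Proof.
move=> c0 bnd; apply.
pose L := cabs q + cabs l + 1.
have q0 := cabs_ge0 q; have l0 := cabs_ge0 l.
have T_lin : linear (fun x => A x - l *: x).
  move=> a x y; rewrite opA_lin scalerDr opprD addrACA scalerBr !scalerA.
  by rewrite (mulrC l).
apply: (@normal_bounded_below_inverse _ _ ip (fun x => A x - l *: x)
  (fun x => As x - l^* *: x) c L) => //.
- by move=> x y; rewrite ipBl ipBr opAdjE ipZl ipZr conjCK.
- move=> x; rewrite opAB opAdjB opAZ opAdjZ opAK opAdjK !scalerBr !scalerA.
  rewrite (mulrC l) !opprB !addrA (addrAC _ _ (- _)) [in RHS]addrC -!addrA.
  exact: addrCA.
- by rewrite /L; lra.
- move=> x; rewrite (le_trans (le_hnormD _ _))// hnorm_opp hnorm_opA hnormZ.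
  rewrite -mulrDl.
  by rewrite ler_wpM2r ?hnorm_ge0// /L lerDl.
Qed.

(** |A x| = |q| |x|, so A - l is bounded below by | |q| - |l| |. *)
Lemma spectrum_circle (l : R[i]) : sigmaA E l -> cabs l = cabs q.
Proof.
move=> sl; apply: contrapT => /eqP lq; move: sl.
apply: (@notin_spectrum _ `|cabs q - cabs l|).
  by rewrite normr_gt0 subr_eq0 eq_sym.
move=> x; rewrite -[X in _ * X]ger0_norm ?hnorm_ge0// -normrM mulrBl.
rewrite -(hnorm_opA x) -hnormZ ler_norml.
have h1 := le_hnormD (A x - l *: x) (l *: x).
have h2 := le_hnormD (- (A x - l *: x)) (A x).
move: h1 h2; rewrite hnorm_opp subrK opprB subrK => h1 h2.
by apply/andP; split; lra.
Qed.

End cyclic_operator_theory.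

(** * The finite models A_N *)

Section finite_models_theory.
Variables (R : realType) (H : completeNormedModType R[i]).
Variables (ip : inner_product H) (E : cyclic_operator ip).
Variable X : finite_models E.
Implicit Types (x y z : H) (a : R[i]).

Local Notation A := (opA E).
Local Notation As := (opAdj E).
Local Notation q := (opq E).
Local Notation rA := (rA E).
Local Notation phi := (cyc E).
Local Notation word := (word E).
Local Notation D := (apD X).
Local Notation lam := (apl X).
Local Notation u := (apu X).

Lemma HN_word N i j : (i <= N)%N -> (j <= N)%N -> HN E N (word i j).
Proof. by move=> iN jN; apply: span_gen; exists i, j. Qed.

Lemma HN_minus_word N i j : (i < N)%N -> (j <= N)%N -> HN_minus E N (word i j).
Proof. by move=> iN jN; apply: span_gen; exists i, j. Qed.

Lemma HN_minus_sub N : HN_minus E N `<=` HN E N.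
Proof.
apply: span_mono => _ [i [j [iN jN ->]]]; exists i, j; split => //.
exact: ltnW.
Qed.

Lemma opA_HN_minus N x : HN_minus E N x -> HN_plus E N (A x).
Proof.
move: x; apply: span_min.
- by rewrite opA0; exact: span0.
- by move=> a x y Hx Hy; rewrite opA_lin; exact: span_lin.
- move=> _ [i [j [iN jN ->]]]; apply: span_gen; exists i.+1, j.
  by rewrite iN jN.
Qed.

Lemma HN_minus_projection N x : exists2 p, HN_minus E N p &
  forall y, HN_minus E N y -> ip y (x - p) = 0.
Proof.
have [p sp pP] := span_projection ip
  [seq word i j | i <- iota 0 N, j <- iota 0 N.+1] x.
have im : [set` [seq word i j | i <- iota 0 N, j <- iota 0 N.+1]] =
    [set x | exists i j, [/\ (i < N)%N, (j <= N)%N & x = word i j]].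
  apply/seteqP; split => [y ys|_ [i [j [iN jN ->]]]].
    have /allpairsP[[i j] []] : y \in _ := ys.
    by rewrite !mem_iota !add0n => iN jN ->; exists i, j.
  by apply/allpairsP; exists (i, j); rewrite !mem_iota !add0n.
by exists p; rewrite /HN_minus -im.
Qed.

(** A_N is sqrt(r_A) times an isometry: on H_N^- it is A, which maps into H_N^+;
    on W^- it is sqrt(r_A) U_N, which maps into the complement of H_N^+. *)
Lemma ip_apA N x y : HN E N x -> HN E N y ->
  ip (apA X N x) (apA X N y) = rA%:C%C * ip x y.
Proof.
have [U_lin U_im U_ip] := apU_unitary X N.
have dec x0 : HN E N x0 -> exists p w, [/\ HN_minus E N p, W_minus E N w,
    x0 = p + w & apA X N x0 = A p + (Num.sqrt rA)%:C%C *: apU X N w].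
  move=> Hx; have [p Hp pP] := HN_minus_projection N x0.
  have Wp : W_minus E N (x0 - p).
    by split=> //; apply: spanB => //; exact: HN_minus_sub.
  exists p, (x0 - p); split => //; first by rewrite addrC subrK.
  have {1}-> : x0 = 1 *: p + (x0 - p) by rewrite scale1r addrC subrK.
  rewrite apA_linear//; last 2 first.
  - exact: HN_minus_sub.
  - by case: Wp.
  by rewrite scale1r apA_minus// apA_W.
move=> /dec[p [w [Hp Ww -> ->]]] /dec[p' [w' [Hp' Ww' -> ->]]].
have Uort v v' : HN_minus E N v -> W_minus E N v' ->
    ip (A v) (apU X N v') = 0.
  move=> Hv Wv; have : W_plus E N (apU X N v') by rewrite -U_im; exists v'.
  by case=> _; apply; exact: opA_HN_minus.
have Wort v v' : HN_minus E N v -> W_minus E N v' -> ip v v' = 0.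
  by move=> Hv [_]; apply.
(* Scalars are named because A x itself unfolds to a scalar multiple. *)
rewrite !(ipDl, ipDr) !(ipZl ip _ (Num.sqrt _)%:C%C).
rewrite !(ipZr ip _ (Num.sqrt _)%:C%C) Uort//.
rewrite (ip_conj ip (A p') (apU X N w)) Uort//.
rewrite (Wort p w')// (ip_conj ip p' w) (Wort p' w)// U_ip// ip_opA.
rewrite rmorph0 !mulr0 !addr0 !add0r.
rewrite real_complexJ mulrA -real_complexM -expr2 sqr_sqrtr ?mulrDr//.
exact: ltW (rA_gt0 E).
Qed.

Lemma HN_apu N (k : 'I_(D N)) : HN E N (u k).
Proof. by rewrite -(apu_basis X N); apply: span_gen; exists k. Qed.

Lemma lam_conj_mul N (k : 'I_(D N)) : (lam k)^* * lam k = rA%:C%C.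
Proof.
have := ip_apA (HN_apu k) (HN_apu k).
by rewrite apu_eigen ipZl ipZr apu_orthonormal eqxx !mulr1.
Qed.

Lemma cabs_lam N (k : 'I_(D N)) : cabs (lam k) = cabs q.
Proof.
apply/eqP; rewrite -(@eqrXn2 _ 2)// ?cabs_ge0//; apply/eqP; apply: complexI.
by rewrite -[RHS](lam_conj_mul k) mulrC -normCK cabsE real_complexX.
Qed.

(** Write u_k = A_N u_k / lam_k and use that A_N is isometric up to scaling. *)
Lemma ip_apu_opA N (k : 'I_(D N)) x : HN_minus E N x ->
  ip (u k) (A x) = lam k * ip (u k) x.
Proof.
move=> Hx; apply: (mulfI (rAC_neq0 E)).
rewrite [RHS]mulrCA -(ip_apA (HN_apu k) (HN_minus_sub Hx)) apu_eigen.
by rewrite (apA_minus X Hx) ipZl [RHS]mulrA (mulrC (lam k)) lam_conj_mul.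
Qed.

Lemma ip_apu_cyc N (k : 'I_(D N)) : ip (u k) phi = (xi k)%:C%C.
Proof. by rewrite /xi RRe_real// ger0_real// apu_cyc_ge0. Qed.

(** The words are A_N^i (A_N^* )^j phi: multiplication by A^* is undone, up to
    r_A, by an application of A to a vector of H_N^-. *)
Lemma ip_apu_word N (k : 'I_(D N)) i j : (i <= N)%N -> (j <= N)%N ->
  ip (u k) (word i j) = lam k ^+ i * (lam k)^* ^+ j * (xi k)%:C%C.
Proof.
move=> iN jN; elim: i iN => [_|i IH iN].
  elim: j jN => [_|j IH jN]; first by rewrite !expr0 !mul1r ip_apu_cyc.
  apply: (mulfI (rAC_neq0 E)).
  have -> w : rA%:C%C * ip (u k) w = (lam k)^* * (lam k * ip (u k) w).
    by rewrite mulrA lam_conj_mul.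
  rewrite -ip_apu_opA; last by apply: HN_minus_word => //; exact: leq_trans jN.
  rewrite (_ : A (word 0 j.+1) = rA%:C%C *: word 0 j); last exact: opAK.
  by rewrite ipZr IH ?(ltnW jN)// !expr0 !mul1r exprS; ring.
rewrite (_ : word i.+1 j = A (word i j)); last by [].
rewrite ip_apu_opA; last exact: HN_minus_word.
by rewrite IH ?(ltnW iN)// exprS !mulrA.
Qed.

(** Otherwise u_k would be orthogonal to all words, which span H_N: phi is
    cyclic for A_N. *)
Lemma xi_gt0 N (k : 'I_(D N)) : 0 < xi k.
Proof.
have xi0 : 0 <= xi k by rewrite -ler0c -ip_apu_cyc apu_cyc_ge0.
rewrite lt_neqAle xi0 andbT eq_sym; apply/eqP => xk0.
have : ip (u k) (u k) = 0.
  rewrite (ip_conj ip) (_ : ip _ _ = 0) ?rmorph0//.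
  apply: (@orth_span _ _ ip _ _ _ _ (HN_apu k)) => _ [i [j [iN jN ->]]].
  by rewrite (ip_conj ip) ip_apu_word// xk0 mulr0 rmorph0.
by rewrite apu_orthonormal eqxx => /eqP; rewrite oner_eq0.
Qed.

Lemma HN_expansion N x : HN E N x -> x = \sum_(k < D N) ip (u k) x *: u k.
Proof.
rewrite -(apu_basis X N); move: x; apply: span_min.
- by rewrite big1// => k _; rewrite ip0r scale0r.
- move=> a x y {1}-> {1}->; rewrite scaler_sumr -big_split /=.
  by apply: eq_bigr => k _; rewrite ip_linear scalerDl scalerA.
- move=> _ [k _ <-]; rewrite (bigD1 k)//= apu_orthonormal eqxx scale1r.
  by rewrite big1 ?addr0// => l lk; rewrite apu_orthonormal (negbTE lk) scale0r.
Qed.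

Lemma parseval_ip N x y : HN E N x ->
  ip x y = \sum_(k < D N) (ip (u k) x)^* * ip (u k) y :> R[i].
Proof.
move=> Hx; rewrite {1}(HN_expansion Hx) ip_suml.
by apply: eq_bigr => k _; rewrite ipZl.
Qed.

Lemma parseval N x : HN E N x ->
  hnorm x ^+ 2 = \sum_(k < D N) cabs (ip (u k) x) ^+ 2.
Proof.
move=> Hx; apply: complexI; rewrite (hnorm_sqr ip).
rewrite (parseval_ip _ Hx) real_complex_sum.
by apply: eq_bigr => k _; rewrite mulrC -normCK cabsE real_complexX.
Qed.

Lemma sum_xi2 N : \sum_(k < D N) xi k ^+ 2 = 1.
Proof.
have H0 : HN E N phi by exact: (@HN_word N 0 0).
have <- : hnorm phi ^+ 2 = 1 by rewrite /hnorm cyc_unit expr1n.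
rewrite (parseval H0); apply: eq_bigr => k _.
by rewrite ip_apu_cyc cabs_real ger0_norm// ltW// xi_gt0.
Qed.

Lemma muN_ge0 N (Y : set R[i]) : 0 <= muN X N Y.
Proof. by apply: sumr_ge0 => k _; rewrite sqr_ge0. Qed.

Lemma muN_le1 N (Y : set R[i]) : muN X N Y <= 1.
Proof.
rewrite -(sum_xi2 N) [leRHS](bigID (fun k => lam k \in Y))/= lerDl.
by apply: sumr_ge0 => k _; rewrite sqr_ge0.
Qed.

Lemma muN_mono N (Y Z : set R[i]) : Y `<=` Z -> muN X N Y <= muN X N Z.
Proof.
move=> YZ; rewrite /muN big_mkcond [leRHS]big_mkcond; apply: ler_sum => k _.
case: ifPn => [/set_mem/YZ/mem_set -> //|_]; case: ifP => // _.
exact: sqr_ge0.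
Qed.

End finite_models_theory.

(** * The measures give mass to neighbourhoods of the spectrum *)

Section spectral_mass.
Variables (R : realType) (H : completeNormedModType R[i]).
Variables (ip : inner_product H) (E : cyclic_operator ip).
Variable X : finite_models E.

Local Notation A := (opA E).
Local Notation As := (opAdj E).
Local Notation q := (opq E).
Local Notation phi := (cyc E).
Local Notation word := (word E).
Local Notation D := (apD X).
Local Notation lam := (apl X).
Local Notation u := (apu X).
Local Notation M := ((apM X)%:R : R).

Lemma HN_plus_sub N : HN_plus E N `<=` HN E N.
Proof.
apply: span_mono => _ [i [j [/andP[_ iN] jN ->]]]; by exists i, j.
Qed.

Let psi (P : {poly {poly R[i]}}) := poly2_apply A As phi P.

Lemma poly2_HN_minus (P : {poly {poly R[i]}}) :
  exists N0, forall N, (N0 <= N)%N -> HN_minus E N (psi P).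
Proof.
exists (size P + \max_(i < size P) size (P`_i)%R)%N => N N0N.
apply: span_sum => i _; apply: span_sum => j _; apply: spanZ.
apply: HN_minus_word.
  by apply: leq_trans N0N; rewrite (leq_trans (ltn_ord i))// leq_addr.
rewrite (leq_trans (ltnW (ltn_ord j)))// (leq_trans _ N0N)//.
apply: leq_trans (leq_addl _ _).
  exact: (leq_bigmax (F := fun i : 'I_(size P) => size (P`_i)%R)).
Qed.

Lemma poly2_coef_bound (P : {poly {poly R[i]}}) : exists2 C : R, 0 < C &
  exists N0, forall N, (N0 <= N)%N -> forall k : 'I_(D N),
    cabs (ip (u k) (psi P)) <= C * xi k.
Proof.
pose C := \sum_(i < size P) \sum_(j < size P`_i)
  cabs P`_i`_j * (cabs q ^+ i * cabs q ^+ j).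
have C0 : 0 <= C.
  apply: sumr_ge0 => i _; apply: sumr_ge0 => j _.
  by rewrite !mulr_ge0 ?exprn_ge0 ?cabs_ge0.
exists (C + 1); first by lra.
exists (size P + \max_(i < size P) size (P`_i)%R)%N => N N0N k.
rewrite mulrDl mul1r (@le_trans _ _ (C * xi k))//; last first.
  by rewrite lerDl ltW// xi_gt0.
rewrite ip_sumr mulr_suml (le_trans (cabs_sum _ _ _))//; apply: ler_sum => i _.
rewrite ip_sumr mulr_suml (le_trans (cabs_sum _ _ _))//; apply: ler_sum => j _.
have iN : (i <= N)%N.
  by rewrite (leq_trans (ltnW (ltn_ord i)))// (leq_trans _ N0N)// leq_addr.
have jN : (j <= N)%N.
  rewrite (leq_trans (ltnW (ltn_ord j)))// (leq_trans _ N0N)//.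
  apply: leq_trans (leq_addl _ _).
  exact: (leq_bigmax (F := fun i : 'I_(size P) => size (P`_i)%R)).
rewrite ipZr -/(word i j) ip_apu_word// !ComplexField.Normc.normcM !cabsX.
by rewrite cabs_conj !cabs_lam cabs_real ger0_norm ?(ltW (xi_gt0 k))// !mulrA.
Qed.

(** A - l is not bounded below, and the strict inequality survives a small
    perturbation of the vector into the dense set of the P(A, A^* ) phi. *)
Lemma spectrum_approx (l : R[i]) (c : R) : sigmaA E l -> 0 < c ->
  exists P, hnorm (A (psi P) - l *: psi P) < c * hnorm (psi P).
Proof.
move=> sl c0; have [x xP] : exists x, hnorm (A x - l *: x) < c * hnorm x.
  apply: contrapT => /forallNP nx; move: sl; apply: (notin_spectrum c0) => x.
  by rewrite leNgt; apply/negP; exact: nx.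
pose L := cabs q + cabs l.
have L0 : 0 <= L by rewrite addr_ge0// cabs_ge0.
pose e := (c * hnorm x - hnorm (A x - l *: x)) / (L + c).
have e0 : 0 < e by rewrite divr_gt0 ?subr_gt0// ltr_wpDl.
have eC0 : 0 < e%:C%C :> R[i] by rewrite ltcR.
have [||y [xy [P _ Py]]] := @cyc_cyclic _ _ _ E (ball x e%:C%C).
- by exists x; exact: ballxx.
- exact: ball_open.
exists P; rewrite /psi Py => {P Py}.
have {}xy : hnorm (x - y) < e by move: xy; rewrite -ball_normE /= hnormE ltcR.
have Ty : hnorm (A y - l *: y) <= hnorm (A x - l *: x) + L * hnorm (x - y).
  have -> : A y - l *: y = A x - l *: x - (A (x - y) - l *: (x - y)).
    have -> : A (x - y) - l *: (x - y) = (A x - l *: x) - (A y - l *: y).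
      rewrite opAB scalerBr !opprB addrACA [RHS]addrACA; congr (_ + _).
      exact: addrC.
    by rewrite opprB addrCA subrr addr0.
  rewrite (le_trans (le_hnormD _ _))// lerD2l hnorm_opp.
  rewrite (le_trans (le_hnormD _ _))//.
  by rewrite hnorm_opp hnorm_opA hnormZ mulrDl.
have xley : hnorm x <= hnorm y + hnorm (x - y).
  by rewrite -{1}(subrK y x) addrC le_hnormD.
have : hnorm (x - y) * (L + c) < c * hnorm x - hnorm (A x - l *: x).
  by rewrite -ltr_pdivlMr// ltr_wpDl.
have h1 := ler_wpM2l (ltW c0) xley; move=> h2.
nra.
Qed.

(** An approximate eigenvector psi = P(A, A^* ) phi at l has most of its mass
    on the eigenvalues close to l, and its coordinates are at most C xi_k with C
    independent of N. *)
Lemma muN_spectrum (l : R[i]) (d : R) : sigmaA E l -> 0 < d ->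
  exists2 c : R, 0 < c & exists N0, forall N, (N0 <= N)%N ->
    c <= muN X N [set z | cabs (z - l) <= d].
Proof.
move=> sl d0; have d20 : 0 < d / 2 by rewrite divr_gt0.
have [P psiP] := spectrum_approx sl d20.
have [C C0 [N1 CP]] := poly2_coef_bound P; have [N2 HP] := poly2_HN_minus P.
set x := psi P in psiP CP HP.
have x0 : 0 < hnorm x.
  by move: psiP; apply: contraTT; rewrite -!leNgt => x0;
    rewrite (le_trans (ler_wpM2l (ltW d20) x0))// mulr0 hnorm_ge0.
exists (3 / 4 * hnorm x ^+ 2 / C ^+ 2).
  by rewrite !(divr_gt0, mulr_gt0, exprn_gt0).
exists (maxn N1 N2) => N; rewrite geq_max => /andP[N1N N2N].
have Hx := HP N N2N; have Hx' := HN_minus_sub Hx.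
have HTx : HN E N (A x - l *: x).
  by apply: spanB; [exact: HN_plus_sub (opA_HN_minus Hx)|exact: spanZ].
pose b (k : 'I_(D N)) := cabs (ip (u k) x) ^+ 2.
have b0 k : 0 <= b k by rewrite sqr_ge0.
have nx : hnorm x ^+ 2 = \sum_k b k by rewrite (parseval X Hx').
have nTx : hnorm (A x - l *: x) ^+ 2 = \sum_k cabs (lam k - l) ^+ 2 * b k.
  rewrite (parseval X HTx); apply: eq_bigr => k _.
  by rewrite ipBr ipZr ip_apu_opA// -mulrBl ComplexField.Normc.normcM exprMn.
have lt2 : hnorm (A x - l *: x) ^+ 2 < (d / 2) ^+ 2 * hnorm x ^+ 2.
  rewrite -exprMn ltr_pXn2r ?nnegrE ?hnorm_ge0//.
  by rewrite mulr_ge0 ?hnorm_ge0 ?(ltW d20).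
have far : d ^+ 2 * \sum_(k | ~~ (lam k \in [set z | cabs (z - l) <= d])) b k
    <= hnorm (A x - l *: x) ^+ 2.
  rewrite nTx mulr_sumr big_mkcond; apply: ler_sum => k _.
  case: ifPn => [kl|_]; last by rewrite mulr_ge0 ?sqr_ge0.
  rewrite ler_wpM2r// lerXn2r ?nnegrE ?cabs_ge0 ?(ltW d0)//.
  by apply: ltW; rewrite ltNge; apply: contra kl => kl; rewrite inE.
have near : \sum_(k | lam k \in [set z | cabs (z - l) <= d]) b k
    <= C ^+ 2 * muN X N [set z | cabs (z - l) <= d].
  rewrite /muN mulr_sumr; apply: ler_sum => k _.
  rewrite -exprMn lerXn2r ?nnegrE ?cabs_ge0//.
    by rewrite mulr_ge0 ?(ltW C0) ?(ltW (xi_gt0 k)).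
  exact: CP.
rewrite ler_pdivrMr ?exprn_gt0// mulrC mulrC [leRHS]mulrC (le_trans _ near)//.
have d2 : 0 < d ^+ 2 by rewrite exprn_gt0.
move: lt2 far nx; rewrite exprMn exprVn.
rewrite [\sum_k b k](bigID (fun k => lam k \in [set z | cabs (z - l) <= d]))/=.
move=> lt2 far nx; have {far}lt3 := le_lt_trans far lt2.
rewrite -(mulrA (d ^+ 2) (2 ^+ 2)^-1) ltr_pM2l// in lt3; rewrite nx in lt3 *.
have -> : 3 / 4 = 1 - (2 ^+ 2)^-1 :> R by field.
by rewrite mulrBl mul1r lerBlDr lerD2l ltW.
Qed.

Lemma square_compact : compact (square X).
Proof.
rewrite (_ : square X = [set z | - M <= complex.Re z <= M /\
    - M <= complex.Im z <= M]); first exact: closed_rectangle_compact.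
by apply/seteqP; split => z; rewrite /square /= !ler_norml.
Qed.

Let circle_square z : cabs z = cabs q -> square X z.
Proof.
move=> zq; have qM : cabs q < M.
  apply: le_lt_trans (apM_rA X).
  by rewrite /rA sqrtr_sqr ger0_norm// cabs_ge0.
split; apply: ltW.
  by rewrite (le_lt_trans (le_Re_cabs _))// zq.
by rewrite (le_lt_trans (le_Im_cabs _))// zq.
Qed.

Lemma spectrum_square : sigmaA E `<=` square X.
Proof. by move=> l /spectrum_circle/circle_square. Qed.

Lemma lam_square N (k : 'I_(D N)) : square X (lam k).
Proof. exact/circle_square/cabs_lam. Qed.

Variables (U : set_system nat) (FU : UltraFilter U).
Hypothesis Ucofinite : forall N0, U [set N | (N0 <= N)%N].
Variable P : refinement X U.

Lemma muN_cvg (Y : set R[i]) :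
  cvg (muN X N Y @[N --> U]) /\ 0 <= mun X U Y <= 1.
Proof.
apply: (ultra_bounded_cvg FU); rewrite (_ : mkset _ = setT).
  exact: filterT.
by apply/seteqP; split => // N _; rewrite /= muN_ge0 muN_le1.
Qed.

Lemma open_rectangle (a b c d : R) :
  open [set z : R[i] | a < complex.Re z < b /\ c < complex.Im z < d].
Proof.
rewrite (_ : mkset _ =
    @complex.Re R @^-1` `]a, b[ `&` @complex.Im R @^-1` `]c, d[).
  apply: openI; apply: open_comp; rewrite ?interval_open//.
  - by move=> z _; exact: Re_continuous.
  - by move=> z _; exact: Im_continuous.
by apply/seteqP; split => z /=; rewrite !in_itv.
Qed.

Lemma rectE (a b c d : R) : - M <= a -> b <= M -> - M <= c -> d <= M ->
  rect X a b c d = [set z | a < complex.Re z < b /\ c < complex.Im z < d].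
Proof.
move=> Ma bM Mc dM; apply/seteqP; split => [z []//|z /= [zab zcd]]; split=> //.
by split; rewrite ler_norml; apply/andP; split; lra.
Qed.

Lemma rect_interior (a b c d : R) :
  - M <= a -> b <= M -> - M <= c -> d <= M ->
  rect X a b c d `<=` interior (square X).
Proof.
move=> Ma bM Mc dM; rewrite rectE//.
apply: (subset_trans (B := interior [set z : R[i] |
  a < complex.Re z < b /\ c < complex.Im z < d])).
  by have /interior_id -> := @open_rectangle a b c d.
by apply: interiorS; rewrite -rectE// => z [].
Qed.

Lemma Sqstar_open Z : Sqstar X (NI P) Z -> open Z.
Proof.
move=> [a [b [c [d [[Na Nb Nc Nd] ->]]]]].
have NIM s : NI P s -> - M <= s <= M by move=> /NI_nice[].
move: Na Nb => /NIM/andP[? ?] /NIM/andP[? ?].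
move: Nc Nd => /NIM/andP[? ?] /NIM/andP[? ?].
by rewrite rectE//; exact: open_rectangle.
Qed.

Lemma mun_ge0 Y : 0 <= mun X U Y.
Proof. by have [_ /andP[]] := muN_cvg Y. Qed.

Lemma mustar_ge0 Y : (0 <= mustar P Y)%E.
Proof.
apply: le_ereal_inf_tmp => _ [Z _ <-].
by apply: nneseries_ge0 => i _ _; rewrite lee_fin mun_ge0.
Qed.

Lemma muN_subadd N (K : set R[i]) (Z : nat -> set R[i]) n :
  K `<=` \bigcup_(i < n) Z i -> muN X N K <= \sum_(0 <= i < n) muN X N (Z i).
Proof.
move=> KZ; rewrite /muN.
under [leRHS]eq_bigr do rewrite big_mkcond.
rewrite exchange_big big_mkcond /=; apply: ler_sum => k _.
have s0 : 0 <= \sum_(0 <= i < n)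
    (if lam k \in Z i then xi k ^+ 2 else 0).
  by apply: sumr_ge0 => i _; case: ifP => // _; rewrite sqr_ge0.
case: ifPn => [/set_mem/KZ[i /= iN Zi]|//].
rewrite big_mkord (bigD1 (Ordinal iN))//= mem_set// lerDl.
by apply: sumr_ge0 => j _; case: ifP => // _; rewrite sqr_ge0.
Qed.

(** Compactness turns a countable cover of a compact set by open rectangles into
    a finite one, on which mu^n is subadditive. *)
Lemma mustar_ge (K Y : set R[i]) (c : R) : compact K ->
  K `<=` Y `&` interior (square X) ->
  (exists N0, forall N, (N0 <= N)%N -> c <= muN X N K) ->
  (c%:E <= mustar P Y)%E.
Proof.
move=> cK KY [N0 cN]; apply: le_ereal_inf_tmp => _ [Z [ZS YZ] <-].
have [D' _ KD'] : finite_subset_cover [set: nat] Z K.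
  move: cK; rewrite compact_cover; apply => [i _|]; first exact: Sqstar_open.
  exact: subset_trans YZ.
pose n := (\max_(i <- finmap.enum_fset D') i).+1.
have KZ : K `<=` \bigcup_(i < n) Z i.
  move=> z /KD'[i iD' Zz]; exists i => //=; rewrite ltnS.
  exact: (@leq_bigmax_seq _ (finmap.enum_fset D') xpredT id).
apply: (@le_trans _ _ (\sum_(0 <= i < n) (mun X U (Z i))%:E)%E).
  rewrite sumEFin lee_fin.
  have cv m : \sum_(0 <= i < m) muN X N (Z i) @[N --> U] -->
      \sum_(0 <= i < m) mun X U (Z i).
    elim: m => [|m IH].
      by rewrite big_geq//; under eq_fun do rewrite big_geq//; exact: cvg_cst.
    rewrite big_nat_recr//=; under eq_fun do rewrite big_nat_recr//=.
    by apply: cvgD => //; exact: (muN_cvg (Z m)).1.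
  rewrite -(cvg_lim _ (cv n))//; apply: limr_ge; first exact: cvgP (cv n).
  apply: filterS (Ucofinite N0) => N /= /cN /le_trans; apply.
  exact: muN_subadd.
by apply: nneseries_lim_ge => i _ _; rewrite lee_fin mun_ge0.
Qed.

(** The compact set is a closed square around l inside the rectangle. *)
Lemma mu_spectrum_gt0 (a b c d : R) l :
  - M <= a -> b <= M -> - M <= c -> d <= M ->
  sigmaA E l -> rect X a b c d l -> (0 < mu P (rect X a b c d))%E.
Proof.
move=> Ma bM Mc dM sl [_ /andP[al lb] /andP[cl ld]].
pose e := Num.min (Num.min (complex.Re l - a) (b - complex.Re l))
  (Num.min (complex.Im l - c) (d - complex.Im l)) / 2.
have e0 : 0 < e by rewrite divr_gt0// !lt_min !subr_gt0 al lb cl ld.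
have [e1 e2 e3 e4] : [/\ 2 * e <= complex.Re l - a, 2 * e <= b - complex.Re l,
    2 * e <= complex.Im l - c & 2 * e <= d - complex.Im l].
  rewrite mulrC divfK//; split; rewrite !ge_min lexx ?orbT//.
pose K := [set z : R[i] |
  complex.Re l - e <= complex.Re z <= complex.Re l + e /\
  complex.Im l - e <= complex.Im z <= complex.Im l + e].
have Krect : K `<=` rect X a b c d.
  rewrite rectE// => z [/andP[? ?] /andP[? ?]].
  by split; apply/andP; split; lra.
have [m m0 [N0 mN]] := muN_spectrum sl e0.
apply: (@lt_le_trans _ _ m%:E); first by rewrite lte_fin.
apply: (@mustar_ge K); first exact: closed_rectangle_compact.
  by move=> z /Krect Rz; split => //; exact: rect_interior Rz.
exists N0 => N /mN /le_trans; apply; apply: muN_mono => z /= zl.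
have := le_trans (le_Re_cabs _) zl; have := le_trans (le_Im_cabs _) zl.
rewrite ReB ImB !ler_norml => /andP[? ?] /andP[? ?].
by split; apply/andP; split; lra.
Qed.

End spectral_mass.

(** * Plateau functions *)

Section bumps.
Variable R : realType.
Implicit Types (x y e : R).

Definition clip x : R := Num.max 0 (Num.min 1 x).

Lemma clip_itv x : 0 <= clip x <= 1.
Proof. by rewrite /clip le_max lexx ge_max ler01 ge_min lexx. Qed.

Lemma clip0 x : x <= 0 -> clip x = 0.
Proof. by move=> x0; rewrite /clip max_l// ge_min x0 orbT. Qed.

Lemma clip1 x : 1 <= x -> clip x = 1.
Proof. by move=> x1; rewrite /clip (min_l x1) max_r. Qed.

Lemma clip_lipschitz x y : `|clip x - clip y| <= `|x - y|.
Proof.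
wlog xy : x y / x <= y.
  move=> W; have [/W//|/ltW/W] := leP x y.
  by rewrite distrC (distrC x).
rewrite (distrC x) (distrC (clip x)) [leRHS]ger0_norm ?subr_ge0//.
have clip_id t : 0 <= t <= 1 -> clip t = t.
  by move=> /andP[t0 t1]; rewrite /clip (min_r t1) max_r.
have clip_cases t : [\/ t <= 0 /\ clip t = 0, 0 <= t <= 1 /\ clip t = t
    | 1 <= t /\ clip t = 1].
  have [t0|t0] := leP t 0; first by apply: Or31; rewrite clip0.
  have [t1|t1] := leP 1 t; first by apply: Or33; rewrite clip1.
  have t01 : 0 <= t <= 1 by rewrite !ltW.
  by apply: Or32; rewrite clip_id.
by case: (clip_cases x) => -[hx ->]; case: (clip_cases y) => -[hy ->];
  rewrite ler_norml; lra.
Qed.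

Lemma clip_continuous (A : set R[i]) (L : R[i] -> R) e : 0 < e ->
  (forall z w, `|L z - L w| <= cabs (z - w)) ->
  {within A, continuous (fun z => (clip (L z / e))%:C%C)}.
Proof.
move=> e0 LL; apply/within_cabsP => x Ax d d0.
exists (d * e); first by rewrite mulr_gt0.
move=> y Ay xy; rewrite -real_complexB cabs_real.
rewrite (le_lt_trans (clip_lipschitz _ _))//.
rewrite -mulrBl normrM (gtr0_norm (x := e^-1)) ?invr_gt0// ltr_pdivrMr//.
exact: le_lt_trans xy.
Qed.

(** A product of ramps: 0 off the open rectangle ]a, b[ x ]c, d[, and 1 at
    distance at least e from its complement. *)
Definition bump (a b c d e : R) (z : R[i]) : R[i] :=
  (clip ((complex.Re z - a) / e))%:C%C * (clip ((b - complex.Re z) / e))%:C%C *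
  (clip ((complex.Im z - c) / e))%:C%C * (clip ((d - complex.Im z) / e))%:C%C.

Lemma bump_continuous (A : set R[i]) a b c d e : 0 < e ->
  {within A, continuous (bump a b c d e)}.
Proof.
move=> e0.
have Rl (t : R) z w : `|complex.Re z - t - (complex.Re w - t)| <= cabs (z - w).
  by rewrite opprB addrA subrK -ReB le_Re_cabs.
have Rr (t : R) z w : `|t - complex.Re z - (t - complex.Re w)| <= cabs (z - w).
  by rewrite opprB addrC addrA subrK -ReB cabs_distC le_Re_cabs.
have Il (t : R) z w : `|complex.Im z - t - (complex.Im w - t)| <= cabs (z - w).
  by rewrite opprB addrA subrK -ImB le_Im_cabs.
have Ir (t : R) z w : `|t - complex.Im z - (t - complex.Im w)| <= cabs (z - w).
  by rewrite opprB addrC addrA subrK -ImB cabs_distC le_Im_cabs.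
move=> x; apply: cvgM; [apply: cvgM; [apply: cvgM|]|].
- exact: (clip_continuous (L := fun z => complex.Re z - a) e0 (Rl a)).
- exact: (clip_continuous (L := fun z => b - complex.Re z) e0 (Rr b)).
- exact: (clip_continuous (L := fun z => complex.Im z - c) e0 (Il c)).
- exact: (clip_continuous (L := fun z => d - complex.Im z) e0 (Ir d)).
Qed.

Lemma bump_real a b c d e z :
  exists2 t : R, 0 <= t <= 1 & bump a b c d e z = t%:C%C.
Proof.
rewrite /bump -!real_complexM.
have /andP[] := clip_itv ((complex.Re z - a) / e).
have /andP[] := clip_itv ((b - complex.Re z) / e).
have /andP[] := clip_itv ((complex.Im z - c) / e).
have /andP[] := clip_itv ((d - complex.Im z) / e).
move: (clip _) (clip _) (clip _) (clip _) => t1 t2 t3 t4 ? ? ? ? ? ? ? ?.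
eexists; last by [].
by rewrite !mulr_ge0//= !mulr_ile1// ?mulr_ge0.
Qed.

Lemma bump_out a b c d e z : 0 < e ->
  ~ (a < complex.Re z < b /\ c < complex.Im z < d) -> bump a b c d e z = 0.
Proof.
move=> e0 zP.
have : [\/ complex.Re z - a <= 0, b - complex.Re z <= 0, complex.Im z - c <= 0 |
           d - complex.Im z <= 0].
  rewrite !subr_le0; have [h1|h1] := leP (complex.Re z) a; first exact: Or41.
  have [h2|h2] := leP b (complex.Re z); first exact: Or42.
  have [h3|h3] := leP (complex.Im z) c; first exact: Or43.
  have [h4|h4] := leP d (complex.Im z); first exact: Or44.
  by exfalso; apply: zP; rewrite h1 h2 h3 h4.
have clipe t : t <= 0 -> clip (t / e) = 0.
  by move=> t0; rewrite clip0// pmulr_lle0// invr_gt0.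
by rewrite /bump => -[] /clipe ->; rewrite ?(mul0r, mulr0).
Qed.

Lemma bump_in a b c d e z : 0 < e ->
  a + e <= complex.Re z <= b - e -> c + e <= complex.Im z <= d - e ->
  bump a b c d e z = 1.
Proof.
move=> e0 /andP[h1 h2] /andP[h3 h4].
have clipe t : e <= t -> clip (t / e) = 1.
  by move=> te; rewrite clip1// ler_pdivlMr// mul1r.
by rewrite /bump !clipe ?mulr1//; lra.
Qed.

End bumps.

(** * Distributions on C(S) *)

Section continuous_functions.
Variables (R : realType) (H : completeNormedModType R[i]).
Variables (ip : inner_product H) (E : cyclic_operator ip).
Variables (X : finite_models E).
Implicit Types (f g : R[i] -> R[i]) (c : R[i]).

Local Notation CS := (CS X).

Lemma CS_cst c : CS (fun=> c).
Proof. by move=> x; exact: cvg_cst. Qed.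

Lemma CSD f g : CS f -> CS g -> CS (fun x => f x + g x).
Proof. by move=> cf cg x; apply: cvgD; [exact: cf|exact: cg]. Qed.

Lemma CSB f g : CS f -> CS g -> CS (fun x => f x - g x).
Proof. by move=> cf cg x; apply: cvgB; [exact: cf|exact: cg]. Qed.

Lemma CSM f g : CS f -> CS g -> CS (fun x => f x * g x).
Proof. by move=> cf cg x; apply: cvgM; [exact: cf|exact: cg]. Qed.

End continuous_functions.

(* CS unfolds to a product, whose binders must not become implicit. *)
Arguments CS_cst {R H ip E X} c.
Arguments CSD {R H ip E X f g} cf cg.
Arguments CSB {R H ip E X f g} cf cg.
Arguments CSM {R H ip E X f g} cf cg.

Section linear_combinations.
Variables (R : realType) (H : completeNormedModType R[i]).
Variables (ip : inner_product H) (E : cyclic_operator ip).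
Variables (X : finite_models E).

Lemma CSZ (c : R[i]) (f : R[i] -> R[i]) : CS X f -> CS X (fun x => c * f x).
Proof. by move=> cf; exact: (CSM (CS_cst c) cf). Qed.

Lemma CS_sum (I : Type) (s : seq I) (F : I -> R[i] -> R[i]) :
  (forall i, CS X (F i)) -> CS X (fun x => \sum_(i <- s) F i x).
Proof.
move=> cF; elim: s => [|i s IH].
  by under eq_fun do rewrite big_nil; exact: (CS_cst 0).
by under eq_fun do rewrite big_cons; exact: (CSD (cF i) IH).
Qed.

End linear_combinations.

Arguments CSZ {R H ip E X} c {f} cf.
Arguments CS_sum {R H ip E X I} s {F} cF.

Lemma CS_lincomb (R : realType) (H : completeNormedModType R[i])
    (ip : inner_product H) (E : cyclic_operator ip) (X : finite_models E)
    (I : Type) (s : seq I) (a : I -> R[i]) (F : I -> R[i] -> R[i]) :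
  (forall i, CS X (F i)) -> CS X (fun x => \sum_(i <- s) a i * F i x).
Proof. by move=> cF; exact: (CS_sum s (fun i => CSZ (a i) (cF i))). Qed.

Arguments CS_lincomb {R H ip E X I} s a {F} cF.

Section distributions.
Variables (R : realType) (H : completeNormedModType R[i]).
Variables (ip : inner_product H) (E : cyclic_operator ip).
Variables (X : finite_models E).
Implicit Types (f g : R[i] -> R[i]) (c : R[i]).

Local Notation CS := (CS X).

Lemma norm_sigma_le f (C : R) : 0 <= C ->
  (forall l, sigmaA E l -> cabs (f l) <= C) -> norm_sigma E f <= C.
Proof.
move=> C0 fC; rewrite /norm_sigma.
have [->|/set0P n0] := eqVneq [set cabs (f l) | l in sigmaA E] set0.
  by rewrite sup0.
by apply: ge_sup => // _ [l sl <-]; exact: fC.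
Qed.

Variables (theta : (R[i] -> R[i]) -> R[i]) (K : nat).
Hypothesis theta_lin : forall a f g, CS f -> CS g ->
  theta (fun x => a * f x + g x) = a^* * theta f + theta g.
Hypothesis theta_bnd : forall f, CS f ->
  cabs (theta f) <= K%:R * norm_sigma E f.

Lemma theta_le f (C : R) : CS f -> 0 <= C ->
  (forall l, sigmaA E l -> cabs (f l) <= C) -> cabs (theta f) <= K%:R * C.
Proof.
move=> cf C0 fC; apply: (le_trans (theta_bnd cf)).
by rewrite ler_wpM2l// norm_sigma_le.
Qed.

Lemma theta_eq0 f : CS f -> (forall l, sigmaA E l -> f l = 0) -> theta f = 0.
Proof.
move=> cf f0; apply/eqP; rewrite -cabs_eq0 eq_le cabs_ge0 andbT.
rewrite -(mulr0 K%:R); apply: theta_le => // l /f0 ->.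
by rewrite ComplexField.Normc.normc0.
Qed.

Lemma thetaD f g : CS f -> CS g ->
  theta (fun x => f x + g x) = theta f + theta g.
Proof.
move=> cf cg; have := theta_lin 1 cf cg; rewrite rmorph1 mul1r => <-.
by congr theta; apply/funext => x; rewrite mul1r.
Qed.

Lemma thetaZ a f : CS f -> theta (fun x => a * f x) = a^* * theta f.
Proof.
move=> cf; have := theta_lin a cf (CS_cst 0).
rewrite (theta_eq0 (CS_cst 0))// addr0 => <-.
by congr theta; apply/funext => x; rewrite addr0.
Qed.

Lemma thetaB f g : CS f -> CS g ->
  theta (fun x => f x - g x) = theta f - theta g.
Proof.
move=> cf cg; have := theta_lin (-1) cg cf; rewrite rmorphN1 mulN1r addrC => <-.
by congr theta; apply/funext => x; rewrite mulN1r addrC.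
Qed.

Lemma theta_sum (I : Type) (s : seq I) (a : I -> R[i]) (F : I -> R[i] -> R[i]) :
  (forall i, CS (F i)) ->
  theta (fun x => \sum_(i <- s) a i * F i x) =
  \sum_(i <- s) (a i)^* * theta (F i).
Proof.
move=> cF; elim: s => [|i s IH].
  rewrite big_nil; under eq_fun do rewrite big_nil.
  by rewrite theta_eq0//; exact: (CS_cst 0).
rewrite big_cons -IH; under eq_fun do rewrite big_cons.
rewrite (thetaD (CSZ (a i) (cF i)) (CS_lincomb s a cF)).
by rewrite (thetaZ (a i) (cF i)).
Qed.

End distributions.

(** * The grids *)

Section grids.
Variables (R : realType) (H : completeNormedModType R[i]).
Variables (ip : inner_product H) (E : cyclic_operator ip).
Variables (X : finite_models E) (U : set_system nat).
Variable theta : (R[i] -> R[i]) -> R[i].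
Variable r : nat -> nat -> R.
Hypothesis r_grid : very_good_grid X U theta r.

Local Notation M := ((apM X)%:R : R).
Local Notation cell := (cell X r).
Local Notation grid_nbhd := (grid_nbhd X r).

Lemma grid_itv n i : (i <= 2 ^ (n + 2))%N -> - M <= r n i <= M.
Proof. by case: r_grid => + _ _ _ _ => /(_ n i); rewrite addn1 ltnS. Qed.

Lemma grid_lt n i j : (i < j)%N -> (j <= 2 ^ (n + 2))%N -> r n i < r n j.
Proof.
case: r_grid => _ step _ _ _.
elim: j => // j IH; rewrite ltnS leq_eqVlt => /predU1P[-> jn|ij jn].
  by case: (step n j jn).
by apply: (lt_trans (IH ij (ltnW jn))); case: (step n j jn).
Qed.

Lemma grid_le n i j : (i <= j)%N -> (j <= 2 ^ (n + 2))%N -> r n i <= r n j.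
Proof.
by rewrite leq_eqVlt => /predU1P[->//|ij jn]; rewrite ltW// grid_lt.
Qed.

(** Grid points of level n are grid points of level n + 1, all in [-M, M]. *)
Lemma grid_ends n : r n 0 = - M /\ r n (2 ^ (n + 2)) = M.
Proof.
case: r_grid => _ _ _ [r0 r4] sub; elim: n => [//|n [IH0 IHM]].
case: (sub n 0%N) => [|i]; first by rewrite addn1.
rewrite addn1 ltnS => im ri.
case: (sub n (2 ^ (n + 2))%N) => [|j]; first by rewrite addn1.
rewrite addn1 ltnS => jm rj.
have /andP[h1 _] := grid_itv (leq0n (2 ^ (n.+1 + 2))).
have /andP[_ h2] := grid_itv (leqnn (2 ^ (n.+1 + 2))).
have h3 := grid_le (leq0n i) im; have h4 := grid_le jm (leqnn _).
by split; apply/eqP; rewrite eq_le; apply/andP; split; lra.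
Qed.

Lemma grid_nbhdS n m e : (n <= m)%N -> grid_nbhd n e `<=` grid_nbhd m e.
Proof.
case: r_grid => _ _ _ _ sub; move=> nm z [i /= im zi].
suff [j jm rj] : exists2 j, (j < 2 ^ (m + 2) + 1)%N & r m j = r n i.
  by exists j => //=; rewrite rj.
elim: m nm => [|m IH]; first by rewrite leqn0 => /eqP n0; subst n; exists i.
rewrite leq_eqVlt => /predU1P[<-|]; first by exists i.
rewrite ltnS => /IH[j jm <-]; have [j' j'm ->] := sub m j jm.
by exists j'.
Qed.

Lemma grid_locate n (e e0 t : R) : e < e0 -> - M <= t <= M ->
  (exists2 i, (i <= 2 ^ (n + 2))%N & `|t - r n i| < e0) \/
  (exists2 i, (i < 2 ^ (n + 2))%N & r n i + e < t < r n i.+1 - e).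
Proof.
move=> ee0 /andP[Mt tM]; have [r0 rM] := grid_ends n.
have [i im /andP[it ti]] : exists2 i, (i < 2 ^ (n + 2))%N &
    r n i <= t <= r n i.+1.
  have : t <= r n (2 ^ (n + 2)) by rewrite rM.
  have : (0 < 2 ^ (n + 2))%N by rewrite expn_gt0.
  move: (leqnn (2 ^ (n + 2))); move: {1 3 4}(2 ^ (n + 2))%N.
  elim=> // k IH km _ tk; have [tk'|tk'] := leP (r n k) t.
    by exists k => //; rewrite tk'.
  have [k0|k0] := posnP k; first by move: tk'; rewrite k0 r0 ltNge Mt.
  by apply: IH (ltnW km) k0 (ltW tk').
have [h1|h1] := leP t (r n i + e).
  left; exists i; first exact: ltnW.
  by rewrite ger0_norm ?subr_ge0//; lra.
have [h2|h2] := leP (r n i.+1 - e) t.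
  by left; exists i.+1 => //; rewrite ler0_norm ?subr_le0//; lra.
by right; exists i => //; rewrite h1.
Qed.

Lemma grid_index_inj n i j (t : R) :
  (i < 2 ^ (n + 2))%N -> (j < 2 ^ (n + 2))%N ->
  r n i < t < r n i.+1 -> r n j < t < r n j.+1 -> i = j.
Proof.
move=> im jm /andP[h1 h2] /andP[h3 h4]; have [ij|ij|//] := ltngtP i j.
  by have := lt_trans h3 (lt_le_trans h2 (grid_le ij (ltnW jm))); rewrite ltxx.
by have := lt_trans h1 (lt_le_trans h4 (grid_le ij (ltnW im))); rewrite ltxx.
Qed.

Lemma cellE n i j : (i < 2 ^ (n + 2))%N -> (j < 2 ^ (n + 2))%N ->
  cell n i j = [set z | r n i < complex.Re z < r n i.+1 /\
                        r n j < complex.Im z < r n j.+1].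
Proof.
move=> im jm; rewrite /cell rectE//.
- by case/andP: (grid_itv (ltnW im)).
- by case/andP: (grid_itv im).
- by case/andP: (grid_itv (ltnW jm)).
- by case/andP: (grid_itv jm).
Qed.

Lemma cell_inj n (p p' : 'I_(2 ^ (n + 2)) * 'I_(2 ^ (n + 2))) z :
  cell n p.1 p.2 z -> cell n p'.1 p'.2 z -> p = p'.
Proof.
case: p p' => [i j] [i' j'] /= [_ hi hj] [_ hi' hj'].
congr pair; apply: val_inj => /=.
  exact: (grid_index_inj (ltn_ord i) (ltn_ord i') hi hi').
exact: (grid_index_inj (ltn_ord j) (ltn_ord j') hj hj').
Qed.

Lemma cell_small n i j z w : (i < 2 ^ (n + 2))%N -> (j < 2 ^ (n + 2))%N ->
  cell n i j z -> cell n i j w -> cabs (z - w) < 4 * M / n.+1%:R.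
Proof.
case: r_grid => _ step _ _ _; move=> im jm [_ zi zj] [_ wi wj].
have [_ si] := step n i im; have [_ sj] := step n j jm.
apply: (le_lt_trans (le_cabs_ReIm _)); rewrite ReB ImB.
rewrite (_ : 4 * M / _ = 2 * M / n.+1%:R + 2 * M / n.+1%:R); last first.
  by rewrite -!mulrDl -natrD.
move: zi zj wi wj => /andP[? ?] /andP[? ?] /andP[? ?] /andP[? ?].
move: (2 * M / _) si sj => b si sj.
by apply: ltrD; rewrite ltr_norml; apply/andP; split; lra.
Qed.

End grids.

(** * The values of theta on the cells *)

Section theta_cells.
Variables (R : realType) (H : completeNormedModType R[i]).
Variables (ip : inner_product H) (E : cyclic_operator ip).
Variables (X : finite_models E) (U : set_system nat) (FU : UltraFilter U).
Hypothesis Ucofinite : forall N0, U [set N | (N0 <= N)%N].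
Variable P : refinement X U.
Variables (theta : (R[i] -> R[i]) -> R[i]) (K : nat).
Hypothesis theta_lin : forall a f g, CS X f -> CS X g ->
  theta (fun x => a * f x + g x) = a^* * theta f + theta g.
Hypothesis theta_bnd : forall f, CS X f ->
  cabs (theta f) <= K%:R * norm_sigma E f.
Variable r : nat -> nat -> R.
Hypothesis r_grid : very_good_grid X U theta r.
Variables (n : nat -> nat) (eps : nat -> R).
Hypothesis ne_good : theta_good P theta r setT n eps.

Local Notation M := ((apM X)%:R : R).
Local Notation cell := (cell X r).
Local Notation grid_nbhd := (grid_nbhd X r).
Local Notation theta_cell := (theta_cell X theta r).
Local Notation sz m := (2 ^ (m + 2))%N.
Local Notation cells m := ('I_(sz m) * 'I_(sz m))%type.

Lemma good_atP N : (0 < n N)%N -> good_at P theta r N (n N) (eps N).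
Proof. by case: ne_good => _ _ [_ /(_ N I)]. Qed.

Lemma n_large m : U [set N | (m < n N)%N].
Proof.
case: ne_good => _ /(_ m.+1 isT) + _ _; apply: filterS => N /= [mN _].
exact: ltnW.
Qed.

Lemma good_delta_le N m : good_delta P r N m <= (2 ^+ m)^-1.
Proof.
rewrite /good_delta; set A := [set d | _].
have A1 : inf A <= 1.
  have [->|/set0P[d Ad]] := eqVneq A set0; first by rewrite inf0.
  have lbA : has_lbound A by exists 0 => _ [i [j [_ _ _ ->]]]; exact: muN_ge0.
  apply: (le_trans (ge_inf lbA Ad)); case: Ad => i [j [_ _ _ ->]].
  exact: muN_le1.
rewrite ler_pdivrMr ?exprn_gt0// mulrC.
rewrite (le_trans A1)// ler_pdivlMr ?exprn_gt0// mul1r ler_weXn2l ?ler1n//.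
by rewrite (leq_trans (leq_addr 2 m))// leq_pmull.
Qed.

(** The grid of level m is contained in that of level n(N) for some N with
    delta_N < d, as delta_N <= 2^(-n(N)); clause (a) of theta-goodness at that N
    applies. *)
Lemma theta_grid_small m (d : R) : 0 < d -> exists2 e0 : R, 0 < e0 &
  forall g, set_function X (grid_nbhd m e0) g -> cabs (theta g) < d.
Proof.
move=> d0.
have [k kd] : exists k, (2 ^+ k)^-1 < d :> R.
  have [k _ kP] : \forall k \near \oo, geometric 1 (2^-1 : R) k < d.
    have := @cvg_geometric R 1 2^-1; rewrite ger0_norm ?invr_ge0//.
    move=> /(_ _)/cvgrPdist_lt/(_ _ d0); rewrite invf_lt1// ltr1n => /(_ isT).
    apply: filterS => k; rewrite sub0r normrN; apply: le_lt_trans.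
    exact: ler_norm.
  by exists k; have := kP k (leqnn k); rewrite /= mul1r exprVn.
have [N /= nN] := filter_ex (n_large (maxn m k)).
have [mN kN] : (m <= n N)%N /\ (k <= n N)%N.
  by move: (ltnW nN); rewrite geq_max => /andP[].
exists (eps N); first by case: ne_good.
move=> g [cg g1 g0]; have [_ + _ _] := good_atP (leq_ltn_trans (leq0n _) nN).
move=> /(_ g) gd; apply: (@lt_trans _ _ (good_delta P r N (n N))).
  apply: gd; split=> // x [Sx nx]; apply: g0; split => // gx.
  by apply: nx; exact: (grid_nbhdS r_grid mN) gx.
apply: (le_lt_trans (good_delta_le N (n N))); apply: le_lt_trans kd.
by rewrite lef_pV2 ?posrE ?exprn_gt0// ler_weXn2l// ler1n.
Qed.

Definition inner m i j (e : R) : set R[i] :=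
  [set x | r m i + e < complex.Re x < r m i.+1 - e /\
           r m j + e < complex.Im x < r m j.+1 - e].

Lemma inner_or_grid m (e e0 : R) x : 0 < e -> e < e0 -> square X x ->
  grid_nbhd m e0 x \/ exists p : cells m, inner m p.1 p.2 e x.
Proof.
move=> ep ee0 Sx; have [Rx Ix] : - M <= complex.Re x <= M /\
    - M <= complex.Im x <= M by case: Sx; rewrite !ler_norml.
have [[i im xi]|[i im xi]] := grid_locate r_grid m ee0 Rx.
  by left; exists i; [rewrite /= addn1 ltnS|left].
have [[j jm xj]|[j jm xj]] := grid_locate r_grid m ee0 Ix.
  by left; exists j; [rewrite /= addn1 ltnS|right].
by right; exists (Ordinal im, Ordinal jm).
Qed.

Lemma inner_cell m (p : cells m) (e : R) :
  0 < e -> inner m p.1 p.2 e `<=` cell m p.1 p.2.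
Proof.
move=> e0; rewrite (cellE r_grid)// => z /= [/andP[? ?] /andP[? ?]].
by split; apply/andP; split; lra.
Qed.

Definition cell_bump m i j (e : R) : R[i] -> R[i] :=
  bump (r m i) (r m i.+1) (r m j) (r m j.+1) e.

Lemma cell_bump_CS m i j (e : R) : 0 < e -> CS X (cell_bump m i j e).
Proof. exact: bump_continuous. Qed.

Lemma cell_bump_le1 m i j (e : R) z : cabs (cell_bump m i j e z) <= 1.
Proof.
rewrite /cell_bump; have [t /andP[t0 t1] ->] := bump_real
  (r m i) (r m i.+1) (r m j) (r m j.+1) e z.
by rewrite cabs_real ger0_norm.
Qed.

Lemma cell_bump_out m (p : cells m) (e : R) z : 0 < e ->
  ~ cell m p.1 p.2 z -> cell_bump m p.1 p.2 e z = 0.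
Proof. by move=> e0; rewrite (cellE r_grid)//; exact: bump_out. Qed.

Lemma cell_bump_in m i j (e : R) z : 0 < e -> inner m i j e z ->
  cell_bump m i j e z = 1.
Proof.
move=> e0 [/andP[h1 h2] /andP[h3 h4]].
by apply: bump_in => //; rewrite !ltW.
Qed.

Lemma cell_bump_set_function m (p : cells m) (e : R) : 0 < e ->
  set_function X (cell m p.1 p.2) (cell_bump m p.1 p.2 e).
Proof.
move=> e0; split; first exact: cell_bump_CS.
  by move=> x _; exact: cell_bump_le1.
by move=> x [_ nx]; exact: cell_bump_out.
Qed.

Lemma theta_grid_small_scaled m (C d : R) : 0 < C -> 0 < d ->
  exists2 e0 : R, 0 < e0 & forall g, CS X g ->
    (forall x, square X x -> cabs (g x) <= C) ->
    (forall x, square X x -> ~ grid_nbhd m e0 x -> g x = 0) ->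
    cabs (theta g) < d.
Proof.
move=> C0 d0; have [e0 e00 e0P] := theta_grid_small m (divr_gt0 d0 C0).
exists e0 => // g cg gC g0.
have CC0 : 0 < cabs (C^-1)%:C%C by rewrite cabs_real gtr0_norm invr_gt0.
have : cabs (theta (fun x => (C^-1)%:C%C * g x)) < d / C.
  apply: e0P; split; first exact: (CSZ _ cg).
    move=> x Sx; rewrite ComplexField.Normc.normcM cabs_real.
    by rewrite gtr0_norm ?invr_gt0// mulrC ler_pdivrMr// mul1r gC.
  by move=> x [Sx nx]; rewrite g0// mulr0.
rewrite (thetaZ theta_lin theta_bnd)// ComplexField.Normc.normcM cabs_conj.
by rewrite cabs_real gtr0_norm ?invr_gt0// mulrC ltr_pM2r ?invr_gt0.
Qed.

(** Two plateau functions of a cell differ only near the grid. *)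
Lemma theta_plateau_cauchy m (p : cells m) (d : R) : 0 < d ->
  exists2 e0 : R, 0 < e0 & forall e e' f g,
    0 < e < e0 -> 0 < e' < e0 ->
    set_function X (cell m p.1 p.2) f -> set_function X (cell m p.1 p.2) g ->
    (forall x, inner m p.1 p.2 e x -> f x = 1) ->
    (forall x, inner m p.1 p.2 e' x -> g x = 1) ->
    cabs (theta f - theta g) < d.
Proof.
move=> d0; have [e0 e00 e0P] := theta_grid_small_scaled m (ltr0n _ 2) d0.
exists e0 => // e e' f g /andP[ep ee0] /andP[e'p e'e0].
move=> [cf f1 f0] [cg g1 g0] fi gi.
rewrite -(thetaB theta_lin)//; apply: e0P; first exact: (CSB cf cg).
  move=> x Sx; rewrite (le_trans (le_normcD _ _))// normcN.
  by rewrite (_ : 2%:R = 1 + 1 :> R)// lerD ?f1 ?g1.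
move=> x Sx nx.
have [xc|xc] := pselect (cell m p.1 p.2 x); last by rewrite f0 ?g0 ?subrr.
pose e1 := Num.max e e'.
have e10 : 0 < e1 by rewrite lt_max ep.
have e1e0 : e1 < e0 by rewrite gt_max ee0.
have [//|[p' xp']] := inner_or_grid m e10 e1e0 Sx.
have pp : p' = p by apply: (cell_inj r_grid) xc; exact: inner_cell xp'.
move: xp'; rewrite pp => -[/andP[h1 h2] /andP[h3 h4]].
have le1 : e <= e1 by rewrite le_max lexx.
have le2 : e' <= e1 by rewrite le_max lexx orbT.
rewrite fi ?gi ?subrr//.
  by split; apply/andP; split; lra.
by split; apply/andP; split; lra.
Qed.

Lemma theta_set_function_le Y f : set_function X Y f -> cabs (theta f) <= K%:R.
Proof.
move=> [cf f1 _]; rewrite -[K%:R]mulr1; apply: (theta_le theta_bnd) => //.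
by move=> l sl; apply: f1; exact: spectrum_square sl.
Qed.

(** The values of theta on plateau functions are bounded by K, so they have a
    limit along U; by the Cauchy property it is the limit for all choices. *)
Lemma theta_cellP m (p : cells m) :
  is_theta_cell X theta r m p.1 p.2 (theta_cell m p.1 p.2).
Proof.
rewrite /theta_cell; apply: xgetPex.
pose e k : R := k.+1%:R^-1.
have ep k : 0 < e k by rewrite invr_gt0.
pose z k := theta (cell_bump m p.1 p.2 (e k)).
have zK k : cabs (z k) <= K%:R.
  by apply: theta_set_function_le; exact: cell_bump_set_function.
have [cRe _] : cvg (complex.Re (z k) @[k --> U]) /\
    - K%:R <= lim (complex.Re (z k) @[k --> U]) <= K%:R.
  apply: (ultra_bounded_cvg FU); apply: filterS filterT => k _ /=.
  by rewrite -ler_norml (le_trans (le_Re_cabs _)).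
have [cIm _] : cvg (complex.Im (z k) @[k --> U]) /\
    - K%:R <= lim (complex.Im (z k) @[k --> U]) <= K%:R.
  apply: (ultra_bounded_cvg FU); apply: filterS filterT => k _ /=.
  by rewrite -ler_norml (le_trans (le_Im_cabs _)).
exists (Complex (lim (complex.Re (z k) @[k --> U]))
                (lim (complex.Im (z k) @[k --> U]))).
set l := Complex _ _ => d d0.
have d20 : 0 < d / 2 by rewrite divr_gt0.
have d40 : 0 < d / 4 by rewrite divr_gt0.
have [e0 e00 e0P] := theta_plateau_cauchy p d20.
exists e0 => // e' e'e0 f ff fi.
have [N0 N0e] : exists N0, e N0 < e0.
  have [k _ /(_ k)] := near_infty_natSinv_lt (PosNum e00).
  by move=> /(_ (leqnn k)) ke; exists k.
have /cvgrPdist_lt/(_ _ d40) UR := cRe.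
have /cvgrPdist_lt/(_ _ d40) UI := cIm.
have [k [[/= kR kI] kN]] := filter_ex (filterI (filterI UR UI) (Ucofinite N0)).
have ke : 0 < e k < e0.
  rewrite ep (le_lt_trans _ N0e)// lef_pV2 ?posrE// ler_nat//.
rewrite -(subrKA (z k)) (le_lt_trans (le_normcD _ _))// (splitr d) ltrD//.
  apply: (e0P e' (e k)) => //.
  - exact: cell_bump_set_function.
  - by move=> x [h1 h2]; exact: fi.
  - by move=> x xi; exact: cell_bump_in.
rewrite cabs_distC (le_lt_trans (le_cabs_ReIm _))// ReB ImB.
by rewrite (_ : d / 2 = d / 4 + d / 4) ?ltrD//; field.
Qed.


(** The plateau functions of such a cell vanish on the spectrum. *)
Lemma theta_cell_eq0 m (p : cells m) :
  (forall l, sigmaA E l -> ~ cell m p.1 p.2 l) -> theta_cell m p.1 p.2 = 0.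
Proof.
move=> sp; apply/eqP; rewrite -cabs_eq0 eq_le cabs_ge0 andbT.
apply/ler_addgt0Pr => d d0; rewrite add0r.
have [e0 e00 e0P] := theta_cellP p d0.
have e2 : 0 < e0 / 2 < e0 by rewrite divr_gt0//= ltr_pdivrMr// ltr_pMr// ltr1n.
have e2p : 0 < e0 / 2 by case/andP: e2.
have := e0P _ e2 _ (cell_bump_set_function p e2p).
rewrite (theta_eq0 theta_bnd); last 2 first.
- exact: cell_bump_CS.
- by move=> l sl; apply: cell_bump_out => //; exact: sp.
rewrite sub0r normcN => h; apply/ltW/h => x h1 h2.
by apply: cell_bump_in.
Qed.

Lemma theta_cell_spectrum m (p : cells m) :
  theta_cell m p.1 p.2 != 0 -> exists2 l, sigmaA E l & cell m p.1 p.2 l.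
Proof.
move=> t0; apply: contrapT => np; move/eqP: t0; apply; apply: theta_cell_eq0.
by move=> l sl cl; apply: np; exists l.
Qed.

Lemma theta_cell_bumps m (d : R) : 0 < d -> exists2 e0 : R, 0 < e0 &
  forall e, 0 < e < e0 -> forall p : cells m,
    cabs (theta (cell_bump m p.1 p.2 e) - theta_cell m p.1 p.2) < d.
Proof.
move=> d0.
have : \forall e \near 0^'+, forall p : cells m,
    0 < e -> cabs (theta (cell_bump m p.1 p.2 e) - theta_cell m p.1 p.2) < d.
  apply: filter_forall => p; have [e0 e00 e0P] := theta_cellP p d0.
  near=> e => e_gt0; apply: (e0P e).
  - by rewrite e_gt0; near: e; exact: nbhs_right_lt.
  - exact: cell_bump_set_function.
  - by move=> x h1 h2; exact: cell_bump_in.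
move=> [e0 /= e00 e0P]; exists e0 => // e /andP[ep ee0] p.
apply: e0P => //=; by rewrite sub0r normrN gtr0_norm.
Unshelve. all: by end_near. Qed.

(** The plateau functions of distinct cells have disjoint supports. *)
Lemma cell_bump_sum_le m (c : cells m -> R[i]) (e eta : R) z :
  0 < e -> 0 <= eta ->
  (forall p : cells m, cell m p.1 p.2 z -> cabs (c p) <= eta) ->
  cabs (\sum_(p : cells m) c p * cell_bump m p.1 p.2 e z) <= eta.
Proof.
move=> e0 eta0 ceta; have [[p0 p0z]|np] :=
    pselect (exists p : cells m, cell m p.1 p.2 z).
  rewrite (bigD1 p0)//= big1 ?addr0; last first.
    move=> p pp0; rewrite cell_bump_out ?mulr0// => pz.
    by move: pp0; rewrite (cell_inj r_grid pz p0z) eqxx.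
  rewrite ComplexField.Normc.normcM -[leRHS]mulr1.
  by rewrite ler_pM ?cabs_ge0 ?cell_bump_le1 ?ceta.
rewrite big1 ?ComplexField.Normc.normc0// => p _.
by rewrite cell_bump_out ?mulr0// => pz; apply: np; exists p.
Qed.

Lemma cell_bump_compl_le1 m (e : R) z : 0 < e ->
  cabs (1 - \sum_(p : cells m) 1 * cell_bump m p.1 p.2 e z) <= 1.
Proof.
move=> e0; have [[p0 p0z]|np] := pselect (exists p : cells m, cell m p.1 p.2 z).
  rewrite (bigD1 p0)//= big1 ?addr0; last first.
    move=> p pp0; rewrite cell_bump_out ?mulr0// => pz.
    by move: pp0; rewrite (cell_inj r_grid pz p0z) eqxx.
  rewrite mul1r /cell_bump; have [t /andP[t0 t1] ->] := bump_real
    (r m p0.1) (r m p0.1.+1) (r m p0.2) (r m p0.2.+1) e z.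
  by rewrite -(real_complexB 1) cabs_real ger0_norm ?subr_ge0// lerBlDr lerDl.
rewrite big1 ?subr0 ?ComplexField.Normc.normc1// => p _.
by rewrite cell_bump_out ?mulr0// => pz; apply: np; exists p.
Qed.

(** Testing theta on a combination of plateau functions with unimodular
    coefficients bounds the total variation of the values on the cells. *)
Lemma sum_theta_cell_le m :
  \sum_(p : cells m) cabs (theta_cell m p.1 p.2) <= K%:R.
Proof.
apply/ler_addgt0Pr => d d0.
pose t (p : cells m) := theta_cell m p.1 p.2.
have cI : 0 < (#|{: cells m}|.+1)%:R :> R by [].
have [e0 e00 e0P] := theta_cell_bumps m (divr_gt0 d0 cI).
pose e := e0 / 2.
have ee0 : 0 < e < e0 by rewrite divr_gt0//= ltr_pdivrMr// ltr_pMr// ltr1n.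
have ep : 0 < e by case/andP: ee0.
(* The phase of t_p, or 0 when t_p = 0. *)
pose w (p : cells m) : R[i] := t p / (cabs (t p))%:C%C.
have wt p : (w p)^* * t p = (cabs (t p))%:C%C.
  have [t0|t0] := eqVneq (t p) 0.
    by rewrite t0 mulr0 ComplexField.Normc.normc0.
  rewrite /w rmorphM /= fmorphV /= real_complexJ mulrAC (mulrC (t p)^*).
  rewrite -normCK cabsE expr2 -mulrA divff ?mulr1//.
  by rewrite real_complex_eq0 cabs_eq0.
have w1 p : cabs (w p) <= 1.
  rewrite /w ComplexField.Normc.normcM ComplexField.Normc.normcV cabs_real.
  rewrite ger0_norm ?cabs_ge0//.
  by have [->|t0] := eqVneq (cabs (t p)) 0; rewrite ?mul0r// divff.
pose f x : R[i] := \sum_(p : cells m) w p * cell_bump m p.1 p.2 e x.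
have cB (p : cells m) : CS X (cell_bump m p.1 p.2 e) by exact: cell_bump_CS.
have cf : CS X f.
  exact: (CS_lincomb _ w cB).
have tf : cabs (theta f) <= K%:R.
  rewrite -[K%:R]mulr1; apply: (theta_le theta_bnd) => // l _.
  by apply: cell_bump_sum_le.
have -> : \sum_(p : cells m) cabs (theta_cell m p.1 p.2) =
    cabs (\sum_(p : cells m) (w p)^* * t p).
  under [in RHS]eq_bigr do rewrite wt.
  rewrite -real_complex_sum cabs_real ger0_norm//.
  by apply: sumr_ge0 => p _; exact: cabs_ge0.
have thf : theta f = \sum_(p : cells m) (w p)^* * theta (cell_bump m p.1 p.2 e).
  apply: (theta_sum theta_lin theta_bnd) => p; exact: cell_bump_CS.
have -> : \sum_(p : cells m) (w p)^* * t p = theta f -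
    \sum_(p : cells m) (w p)^* * (theta (cell_bump m p.1 p.2 e) - t p).
  rewrite thf -sumrB; apply: eq_bigr => p _.
  by rewrite mulrBr opprB addrC subrK.
rewrite (le_trans (le_normcD _ _))// normcN lerD//.
rewrite (le_trans (cabs_sum _ _ _))//.
apply: (@le_trans _ _ (\sum_(p : cells m) d / (#|{: cells m}|.+1)%:R)).
  apply: ler_sum => p _; rewrite ComplexField.Normc.normcM cabs_conj.
  rewrite -[leRHS]mul1r ler_pM ?cabs_ge0 ?w1//.
  by apply: ltW; exact: e0P.
have -> : \sum_(p : cells m) d / (#|{: cells m}|.+1)%:R =
    d / (#|{: cells m}|.+1)%:R * (#|{: cells m}|)%:R.
  by rewrite sumr_const mulr_natr.
by rewrite mulrAC ler_pdivrMr// ler_wpM2l ?(ltW d0)// ler_nat.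
Qed.

(** With plateau functions B_p, g = sum (g - h_p) B_p + sum h_p B_p +
    g (1 - sum B_p): the first sum is at most eta, the second gives the step
    approximation, and the last term is supported near the grid. *)
Lemma theta_step_approx m (g : R[i] -> R[i]) (eta : R)
    (h : cells m -> R[i]) : CS X g -> 0 <= eta ->
  (forall (p : cells m) x, cell m p.1 p.2 x -> cabs (g x - h p) <= eta) ->
  cabs (theta g - \sum_(p : cells m) (h p)^* * theta_cell m p.1 p.2) <=
    K%:R * eta.
Proof.
move=> cg eta0 gh; apply/ler_addgt0Pr => d d0.
have d20 : 0 < d / 2 by rewrite divr_gt0.
have cS := @square_compact _ _ _ _ X.
have [C C0 gC] := compact_cabs_bounded cS cg.
have [e1 e10 e1P] := theta_grid_small_scaled m C0 d20.
pose Hs := 1 + \sum_(p : cells m) cabs (h p).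
have Hs0 : 0 < Hs by rewrite ltr_wpDr// sumr_ge0// => p _; exact: cabs_ge0.
have [e2 e20 e2P] := theta_cell_bumps m (divr_gt0 d20 Hs0).
pose e := Num.min e1 e2 / 2.
have ep : 0 < e by rewrite divr_gt0// lt_min e10.
have e12 : e < e1 /\ e < e2.
  have : e < Num.min e1 e2.
    by rewrite ltr_pdivrMr// ltr_pMr ?ltr1n// lt_min e10.
  by rewrite lt_min => /andP[].
pose B (p : cells m) := cell_bump m p.1 p.2 e.
have cB p : CS X (B p) by exact: cell_bump_CS.
pose s x : R[i] := \sum_(p : cells m) 1 * B p x.
have cs : CS X s by exact: (CS_lincomb _ (fun=> 1) cB).
pose t1 x : R[i] := \sum_(p : cells m) (g x - h p) * B p x.
have ct1 : CS X t1.
  exact: (CS_sum _ (fun p => CSM (CSB cg (CS_cst (h p))) (cB p))).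
pose t2 x : R[i] := \sum_(p : cells m) h p * B p x.
have ct2 : CS X t2 by exact: (CS_lincomb _ h cB).
pose t3 x : R[i] := g x * (1 - s x).
have ct3 : CS X t3.
  exact: (CSM cg (CSB (CS_cst 1) cs)).
have gE : g = fun x => t1 x + t2 x + t3 x.
  apply/funext => x; rewrite /t1 /t2 /t3 /s -big_split /=.
  under eq_bigr do rewrite -mulrDl subrK.
  under [in X in _ + X]eq_bigr do rewrite mul1r.
  by rewrite -mulr_sumr -mulrDr addrC subrK mulr1.
have tg : theta g = theta t1 + theta t2 + theta t3.
  rewrite {1}gE (thetaD theta_lin (CSD ct1 ct2) ct3).
  by rewrite (thetaD theta_lin ct1 ct2).
have th1 : cabs (theta t1) <= K%:R * eta.
  apply: (theta_le theta_bnd) => // l _.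
  by apply: cell_bump_sum_le => // p; exact: gh.
have th3 : cabs (theta t3) < d / 2.
  apply: e1P => // x Sx.
    rewrite ComplexField.Normc.normcM -[leRHS]mulr1 ler_pM ?cabs_ge0 ?gC//.
    exact: cell_bump_compl_le1.
  move=> nx; have [//|[p px]] := inner_or_grid m ep e12.1 Sx.
  rewrite /t3 /s (bigD1 p)//= [B p x]cell_bump_in// mul1r big1 ?addr0.
    by rewrite subrr mulr0.
  move=> p' pp'; rewrite mul1r [B p' x]cell_bump_out// => p'x.
  by move: pp'; rewrite (cell_inj r_grid p'x (inner_cell ep px)) eqxx.
have th2 : cabs (theta t2 -
    \sum_(p : cells m) (h p)^* * theta_cell m p.1 p.2) <= d / 2.
  rewrite (theta_sum theta_lin theta_bnd)// -sumrB.
  rewrite (le_trans (cabs_sum _ _ _))//.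
  apply: (@le_trans _ _ (\sum_(p : cells m) cabs (h p) * (d / 2 / Hs))).
    apply: ler_sum => p _; rewrite -mulrBr ComplexField.Normc.normcM cabs_conj.
    by rewrite ler_wpM2l ?cabs_ge0// ltW// e2P// ep e12.2.
  rewrite -mulr_suml mulrCA ger_pMr// ler_pdivrMr// mul1r.
  by rewrite lerDr.
rewrite tg; move: th2; set S := \sum_(p : cells m) _ => th2.
have -> : theta t1 + theta t2 + theta t3 - S =
    theta t1 + (theta t2 - S) + theta t3 by ring.
apply: (le_trans (le_normcD _ _)).
rewrite (splitr d) [leRHS]addrA lerD//; last exact: ltW.
by apply: (le_trans (le_normcD _ _)); rewrite lerD.
Qed.

End theta_cells.

(** * The vectors F_N(f) and u_N(theta) *)

Section levelwise.
Variables (R : realType) (H : completeNormedModType R[i]).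
Variables (ip : inner_product H) (E : cyclic_operator ip).
Variables (X : finite_models E) (U : set_system nat) (FU : UltraFilter U).
Hypothesis Ucofinite : forall N0, U [set N | (N0 <= N)%N].
Variable P : refinement X U.
Variables (theta : (R[i] -> R[i]) -> R[i]) (K : nat).
Hypothesis theta_lin : forall a f g, CS X f -> CS X g ->
  theta (fun x => a * f x + g x) = a^* * theta f + theta g.
Hypothesis theta_bnd : forall f, CS X f ->
  cabs (theta f) <= K%:R * norm_sigma E f.
Variable r : nat -> nat -> R.
Hypothesis r_grid : very_good_grid X U theta r.
Variables (n : nat -> nat) (eps : nat -> R).
Hypothesis ne_good : theta_good P theta r setT n eps.

Local Notation M := ((apM X)%:R : R).
Local Notation D := (apD X).
Local Notation lam := (apl X).
Local Notation u := (apu X).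
Local Notation cell := (cell X r).
Local Notation sz m := (2 ^ (m + 2))%N.
Local Notation cells m := ('I_(sz m) * 'I_(sz m))%type.
Local Notation tc m p := (theta_cell X theta r m p.1 p.2).
Local Notation mcell N p := (muN X N (cell (n N) p.1 p.2)).
Local Notation uth := (uN_theta P theta r n).

Lemma mu_ge0 Y : (0 <= mu P Y)%E.
Proof. exact: (mustar_ge0 FU). Qed.

(** Clause (b) of theta-goodness bounds a sum of squares by delta_N, so delta_N,
    and the minimum that defines it, is positive. *)
Lemma muN_cell_gt0 N (p : cells (n N)) : (0 < n N)%N ->
  mu P (cell (n N) p.1 p.2) != 0%E -> 0 < mcell N p.
Proof.
move=> nN mu0; have [_ _ d0 _] := good_atP ne_good nN.
have {d0} : 0 < good_delta P r N (n N).
  by apply: le_lt_trans d0; apply: sumr_ge0 => k _; rewrite sqr_ge0.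
rewrite /good_delta; set A := [set d | _] => A0.
have {A0} A0 : 0 < inf A.
  by move: A0; rewrite pmulr_lgt0// invr_gt0 exprn_gt0.
apply: (lt_le_trans A0); apply: ge_inf.
  by exists 0 => _ [i [j [_ _ _ ->]]]; exact: muN_ge0.
by exists p.1, p.2; split => //; rewrite lt_neqAle eq_sym mu0 mu_ge0.
Qed.

(** Such a cell meets the spectrum, near which the measure has mass. *)
Lemma theta_cell_mu m (p : cells m) :
  tc m p != 0 -> mu P (cell m p.1 p.2) != 0%E.
Proof.
move=> t0; have [l sl cl] :=
  theta_cell_spectrum FU Ucofinite theta_lin theta_bnd r_grid ne_good t0.
suff : (0 < mu P (cell m p.1 p.2))%E by rewrite lt0e => /andP[].
apply: (mu_spectrum_gt0 FU Ucofinite P _ _ _ _ sl cl).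
- by case/andP: (grid_itv r_grid (ltnW (ltn_ord p.1))).
- by case/andP: (grid_itv r_grid (ltn_ord p.1)).
- by case/andP: (grid_itv r_grid (ltnW (ltn_ord p.2))).
- by case/andP: (grid_itv r_grid (ltn_ord p.2)).
Qed.

Lemma HN_uN_theta N : HN E N (uth N).
Proof.
apply: span_sum => i _; apply: span_sum => j _; apply: span_sum => k _.
by apply: spanZ; exact: HN_apu.
Qed.

Lemma HN_FN f N : HN E N (FN X f N).
Proof. by apply: span_sum => k _; apply: spanZ; exact: HN_apu. Qed.

Lemma coef_FN f N (k : 'I_(D N)) :
  ip (u k) (FN X f N) = (xi k)%:C%C * f (lam k).
Proof.
rewrite ip_sumr (bigD1 k)//= ipZr apu_orthonormal eqxx mulr1.
rewrite big1 ?addr0// => l lk.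
by rewrite ipZr apu_orthonormal eq_sym (negbTE lk) mulr0.
Qed.

Lemma coef_uN_theta N (k : 'I_(D N)) :
  ip (u k) (uth N) = \sum_(p : cells (n N) | mu P (cell (n N) p.1 p.2) != 0%E)
    if lam k \in cell (n N) p.1 p.2 then
      (xi k)%:C%C * tc (n N) p / (mcell N p)%:C%C else 0.
Proof.
rewrite /uN_theta pair_big_dep/= ip_sumr; apply: eq_bigr => p _.
rewrite ip_sumr big_mkcond (bigD1 k)//= ipZr apu_orthonormal eqxx mulr1.
rewrite big1 ?addr0// => l lk; case: ifP => // _.
by rewrite ipZr apu_orthonormal eq_sym (negbTE lk) mulr0.
Qed.

(** The coordinates of u_N(theta) carry, cell by cell, the values of theta; the
    weights xi_k^2 / mu_N of a cell add up to 1. *)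
Lemma sum_uN_theta_le N (g : 'I_(D N) -> R) (G : R) : (0 < n N)%N ->
  (forall k, 0 <= g k) -> 0 <= G ->
  (forall (p : cells (n N)) k, tc (n N) p != 0 ->
     cell (n N) p.1 p.2 (lam k) -> g k <= G) ->
  \sum_k g k * (xi k * cabs (ip (u k) (uth N))) <= K%:R * G.
Proof.
move=> nN g0 G0 gG; set m := n N.
pose w (p : cells m) := cabs (tc m p) / mcell N p.
pose Q (p : cells m) := mu P (cell m p.1 p.2) != 0%E.
have w0 p : 0 <= w p by rewrite divr_ge0 ?cabs_ge0 ?muN_ge0.
apply: (@le_trans _ _ (\sum_k \sum_(p | Q p)
    if lam k \in cell m p.1 p.2 then w p * (g k * xi k ^+ 2) else 0)).
  apply: ler_sum => k _; rewrite coef_uN_theta.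
  rewrite (le_trans (ler_wpM2l (g0 k) (ler_wpM2l (ltW (xi_gt0 k))
    (cabs_sum _ _ _))))//.
  rewrite mulr_sumr mulr_sumr; apply: ler_sum => p _.
  case: ifP => _; last first.
    by rewrite ComplexField.Normc.normc0 !mulr0.
  rewrite !ComplexField.Normc.normcM ComplexField.Normc.normcV !cabs_real.
  rewrite !ger0_norm ?muN_ge0 ?(ltW (xi_gt0 k))// /w expr2.
  by rewrite le_eqVlt; apply/orP; left; apply/eqP; ring.
rewrite exchange_big /=.
apply: (@le_trans _ _ (\sum_(p : cells m) cabs (tc m p) * G)).
  rewrite big_mkcond; apply: ler_sum => p _; case: ifPn => [Qp|_]; last first.
    by rewrite mulr_ge0 ?cabs_ge0.
  have [t0|t0] := eqVneq (tc m p) 0.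
    rewrite /w t0 ComplexField.Normc.normc0 !mul0r big1// => k _.
    by rewrite mul0r; case: ifP.
  have mp := muN_cell_gt0 nN Qp.
  apply: (@le_trans _ _ (w p * (G * mcell N p))).
    rewrite -big_mkcond -mulr_sumr ler_wpM2l// /muN mulr_sumr.
    apply: ler_sum => k /set_mem kp; rewrite ler_wpM2r ?sqr_ge0//.
    exact: gG kp.
  by rewrite le_eqVlt /w; apply/orP; left; apply/eqP; field; rewrite gt_eqF.
rewrite -mulr_suml ler_wpM2r//.
exact: (sum_theta_cell_le FU Ucofinite theta_lin theta_bnd r_grid ne_good).
Qed.

(** On a cell of measure 0, where theta vanishes, the value only has to be close
    to those of f on the cell. *)
Definition cell_average f N (p : cells (n N)) : R[i] :=
  if mu P (cell (n N) p.1 p.2) != 0%E then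
    (\sum_(k < D N | lam k \in cell (n N) p.1 p.2) (xi k ^+ 2)%:C%C * f (lam k))
      / (mcell N p)%:C%C
  else f (xget 0 (cell (n N) p.1 p.2)).

Lemma ip_FN_uN_theta f N :
  ip (FN X f N) (uth N) =
  \sum_(p : cells (n N)) (cell_average f p)^* * tc (n N) p.
Proof.
set m := n N; pose Q (p : cells m) := mu P (cell m p.1 p.2) != 0%E.
rewrite (parseval_ip X _ (HN_FN f N)).
transitivity (\sum_(k < D N) \sum_(p | Q p) if lam k \in cell m p.1 p.2 then
    ((xi k)%:C%C * (xi k)%:C%C * (f (lam k))^*) * (tc m p / (mcell N p)%:C%C)
    else 0).
  apply: eq_bigr => k _; rewrite coef_uN_theta coef_FN mulr_sumr.
  apply: eq_bigr => p _; case: ifP => _; last by rewrite mulr0.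
  by rewrite rmorphM /= real_complexJ; ring.
rewrite exchange_big /= big_mkcond; apply: eq_bigr => p _.
case: ifPn => [Qp|nQp]; last first.
  have [->|t0] := eqVneq (tc m p) 0; first by rewrite mulr0.
  by move: nQp; rewrite /Q (theta_cell_mu t0).
rewrite /cell_average -/m [mu P _ != 0%E]Qp rmorphM fmorphV /= real_complexJ.
rewrite [(\sum_(k < D N | _) _)^*]rmorph_sum /= -mulrA mulr_suml -big_mkcond.
apply: eq_bigr => k _.
by rewrite rmorphM /= real_complexJ expr2 real_complexM; ring.
Qed.

Lemma cell_average_le f N (eta : R) (p : cells (n N)) x : (0 < n N)%N ->
  (forall x y, cell (n N) p.1 p.2 x -> cell (n N) p.1 p.2 y ->
     cabs (f x - f y) <= eta) ->
  cell (n N) p.1 p.2 x -> cabs (f x - cell_average f p) <= eta.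
Proof.
move=> nN fp px; rewrite /cell_average; case: ifPn => [Qp|_]; last first.
  by apply: fp => //; apply: xgetPex; exists x.
have mp := muN_cell_gt0 nN Qp.
have mp0 : (mcell N p)%:C%C != 0 :> R[i] by rewrite real_complex_eq0 gt_eqF.
rewrite -[f x](mulfK mp0) -mulrBl ComplexField.Normc.normcM.
rewrite ComplexField.Normc.normcV cabs_real gtr0_norm// ler_pdivrMr//.
rewrite {1}/muN real_complex_sum mulr_sumr -sumrB (le_trans (cabs_sum _ _ _))//.
rewrite /muN mulr_sumr; apply: ler_sum => k /set_mem kp.
rewrite mulrC -mulrBr ComplexField.Normc.normcM cabs_real ger0_norm ?sqr_ge0//.
by rewrite mulrC ler_wpM2r ?sqr_ge0// fp.
Qed.

Lemma cell_diameter_small (d : R) : 0 < d ->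
  U [set N | (0 < n N)%N /\ 4 * M / (n N).+1%:R < d].
Proof.
move=> d0; pose k := Num.truncn (4 * M / d).
apply: filterS (n_large FU ne_good k) => N /= kn.
split; first exact: leq_ltn_trans kn.
rewrite ltr_pdivrMr// -ltr_pdivrMl// (mulrC d^-1).
have : 4 * M / d < k.+1%:R by rewrite truncnS_gt.
by move=> /lt_le_trans; apply; rewrite ler_nat ltnW.
Qed.

(** The pairing is a step approximation of theta(f), with the averages of f over
    the cells as step values; these are uniformly close to f when the cells are
    small. *)
Lemma ip_FN_uN_theta_cvg f (e : R) : CS X f -> 0 < e ->
  U [set N | cabs (ip (FN X f N) (uth N) - theta f) < e].
Proof.
move=> cf e0; have cS := @square_compact _ _ _ _ X.
have K0 : 0 < K.+1%:R :> R by [].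
have [d d0 dP] := compact_cabs_unif cS cf (divr_gt0 e0 K0).
apply: filterS (cell_diameter_small d0) => N /= [nN nd].
rewrite cabs_distC ip_FN_uN_theta.
apply: (@le_lt_trans _ _ (K%:R * (e / K.+1%:R))).
  apply: (theta_step_approx FU Ucofinite theta_lin theta_bnd r_grid ne_good).
  - by [].
  - by rewrite divr_ge0// ltW.
  move=> p x; apply: cell_average_le => // y z yp zp; apply/ltW/dP.
  - by case: yp.
  - by case: zp.
  apply: lt_trans nd.
  exact: (cell_small r_grid (ltn_ord p.1) (ltn_ord p.2)).
by rewrite mulrCA gtr_pMr// ltr_pdivrMr// mul1r ltr_nat.
Qed.

Lemma dist_sigma_le z l : sigmaA E l -> dist_sigma E z <= cabs (z - l).
Proof.
move=> sl; apply: ge_inf; last by exists l.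
by exists 0 => _ [l' _ <-]; exact: cabs_ge0.
Qed.

Lemma theta_cell_near_spectrum m (p : cells m) z : tc m p != 0 ->
  cell m p.1 p.2 z -> dist_sigma E z < 4 * M / m.+1%:R.
Proof.
move=> t0 zp; have [l sl lp] :=
  theta_cell_spectrum FU Ucofinite theta_lin theta_bnd r_grid ne_good t0.
apply: (le_lt_trans (dist_sigma_le z sl)).
exact: (cell_small r_grid (ltn_ord p.1) (ltn_ord p.2)).
Qed.

End levelwise.

(** * Ultraproducts and the norm at infinity *)

Section ultraproducts.
Variables (U : set_system nat) (FU : UltraFilter U).

Lemma ultra_reprK (T : nat -> Type) (x : forall N, T N) :
  U [set N | ultra_repr (ultra_class FU x) N = x N].
Proof.
have /eqmodP/asboolP : ultra_class FU (ultra_repr (ultra_class FU x)) =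
    ultra_class FU x by rewrite /ultra_class /ultra_repr reprK.
by [].
Qed.

Lemma infinitely_closeP (K : numDomainType) (x : nat -> K) (q : K) :
  infinitely_close (ultra_class FU x : ultrapower FU K) q <->
  forall e : K, 0 < e -> U [set N | `|x N - q| < e].
Proof.
by split=> xq e e0; apply: filterS2 (ultra_reprK x) (xq e e0) => N /= ->.
Qed.

Lemma nat_boundedP (K : numDomainType) (x : nat -> K) :
  nat_bounded (ultra_class FU x : ultrapower FU K) <->
  exists p : nat, U [set N | `|x N| <= p%:R].
Proof.
by split=> -[p xp]; exists p; apply: filterS2 (ultra_reprK x) xp => N /= ->.
Qed.

End ultraproducts.

Section ultra_vectors.
Variables (R : realType) (H : completeNormedModType R[i]).
Variables (ip : inner_product H) (E : cyclic_operator ip).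
Variables (X : finite_models E) (U : set_system nat) (FU : UltraFilter U).
Implicit Types v w : Hu E FU.

Local Notation D := (apD X).
Local Notation lam := (apl X).
Local Notation u := (apu X).

Lemma HN_component v N : HN E N (component v N).
Proof. exact: set_mem (valP (ultra_repr v N)). Qed.

Lemma component_Hu_of (x : nat -> H) : (forall N, HN E N (x N)) ->
  U [set N | component (Hu_of E FU x) N = x N].
Proof.
move=> Hx; apply: filterS (ultra_reprK FU (fun N =>
  insubd (HN_zero E N) (x N))) => N /= xN.
by rewrite /component xN val_insubd mem_set.
Qed.

Lemma coef_Hu_of (x : nat -> H) : (forall N, HN E N (x N)) ->
  U [set N | forall k : 'I_(D N), coef (Hu_of E FU x) k = ip (u k) (x N)].
Proof.
move=> /component_Hu_of; apply: filterS => N /= xN k.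
by rewrite /coef xN.
Qed.

Lemma coef_Hu_sub v w :
  U [set N | forall k : 'I_(D N),
    coef (Hu_sub v w) k = coef v k - coef w k].
Proof.
have /coef_Hu_of : forall N, HN E N (component v N - component w N).
  by move=> N; apply: spanB; exact: HN_component.
by apply: filterS => N /= vw k; rewrite vw ipBr.
Qed.

Lemma ipuE v w (N : nat) :
  ip (component v N) (component w N) =
  \sum_(k < D N) (coef v k)^* * coef w k.
Proof. exact: (parseval_ip X _ (HN_component v N)). Qed.

Definition inf_bounded v := exists (p : nat) (Z : set nat), U Z /\
  forall N, Z N -> forall k : 'I_(D N), cabs (coef v k) * (xi k)^-1 < p%:R.

Section bounded.
Variables (v : Hu E FU) (p : nat) (Z : set nat).
Hypothesis UZ : U Z.
Hypothesis Zp : forall N, Z N ->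
  forall k : 'I_(D N), cabs (coef v k) * (xi k)^-1 < p%:R.

Let s (e : R) := normY_inf X (sigma_nbhd E e) v.

Let values e N : set R :=
  [set (xi k)^-1 * cabs (coef v k) | k in
     [set k : 'I_(D N) | sigma_nbhd E e (lam k)]].

Let values_itv e N : Z N -> forall t, values e N t -> 0 <= t <= p%:R.
Proof.
move=> ZN _ [k _ <-]; rewrite mulr_ge0 ?cabs_ge0 ?invr_ge0 ?(ltW (xi_gt0 k))//=.
by rewrite mulrC ltW// Zp.
Qed.

Let ubound_values e N : Z N -> has_ubound (values e N).
Proof. by move=> ZN; exists p%:R => t /(values_itv ZN)/andP[]. Qed.

Let s_itv e N : Z N -> 0 <= s e N <= p%:R.
Proof.
move=> ZN; rewrite /s /normY_inf -/(values e N).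
have [->|/set0P[t vt]] := eqVneq (values e N) set0.
  by rewrite sup0 lexx /=.
have /andP[t0 tp] := values_itv ZN vt.
rewrite (le_trans t0) ?ub_le_sup//=; last exact: ubound_values.
by apply: ge_sup; [exists t|move=> t' /(values_itv ZN)/andP[]].
Qed.

Let s_cvg e : cvg (s e N @[N --> U]) /\ 0 <= lim (s e N @[N --> U]) <= p%:R.
Proof.
by apply: (ultra_bounded_cvg FU); apply: filterS UZ => N; exact: s_itv.
Qed.

Let norm_inf_epsE e : norm_inf_eps X v e = (lim (s e N @[N --> U]))%:E.
Proof.
by rewrite /norm_inf_eps; case: asboolP => // -[]; exact: (s_cvg e).1.
Qed.

Let norm_inf_eps_mono :
  {homo norm_inf_eps X v : e e' / e <= e' >-> (e <= e')%E}.
Proof.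
move=> e e' ee'; rewrite !norm_inf_epsE lee_fin.
apply: ler_lim; [exact: (s_cvg e).1|exact: (s_cvg e').1|].
apply: filterS UZ => N ZN; rewrite /s /normY_inf.
rewrite -/(values e N) -/(values e' N).
have [->|/set0P vn0] := eqVneq (values e N) set0.
  by rewrite sup0; have /andP[] := s_itv e' ZN.
apply: ge_sup => // _ [k kl <-]; apply: ub_le_sup; first exact: ubound_values.
by exists k => //; exact: le_trans kl ee'.
Qed.

(* The neighbourhoods of the spectrum shrink with e. *)
Let norm_inf_cvg : norm_inf_eps X v e @[e --> 0^'+] -->
  ereal_inf (norm_inf_eps X v @` [set` Interval (BRight 0) (BLeft 1)]).
Proof.
apply: nondecreasing_at_right_cvge; first by rewrite bnd_simp.
by move=> e e' _ _; exact: norm_inf_eps_mono.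
Qed.

Let norm_infE : norm_inf X v =
  ereal_inf (norm_inf_eps X v @` [set` Interval (BRight 0) (BLeft 1)]).
Proof.
rewrite /norm_inf; case: asboolP => [_|[]]; first exact: cvg_lim norm_inf_cvg.
by exists p, Z.
Qed.

Lemma norm_inf_lty : (norm_inf X v < +oo)%E.
Proof.
apply: (@le_lt_trans _ _ (norm_inf_eps X v 2^-1)); last first.
  by rewrite norm_inf_epsE ltry.
rewrite norm_infE; apply: ereal_inf_lbound; exists 2^-1 => //=.
by rewrite in_itv /= invr_gt0 ltr0n invf_lt1 ?ltr1n.
Qed.

(** The limit that defines the norm is an infimum over e, and each of its terms
    is an ultralimit of suprema over the eigenvalues near the spectrum. *)
Lemma norm_inf0_near : norm_inf X v = 0%E -> forall eta : R, 0 < eta ->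
  exists2 e : R, 0 < e & U [set N | forall k : 'I_(D N),
    dist_sigma E (lam k) <= e -> (xi k)^-1 * cabs (coef v k) < eta].
Proof.
move=> v0 eta eta0.
have : (norm_inf X v < eta%:E)%E by rewrite v0 lte_fin.
rewrite norm_infE => /ereal_inf_lt[_ [e /= e01 <-]].
rewrite norm_inf_epsE lte_fin => se.
exists e; first by move: e01; rewrite in_itv /= => /andP[].
have : s e N @[N --> U] --> lim (s e N @[N --> U]) by exact: (s_cvg e).1.
move=> /cvgr_lt/(_ _ se) sU; apply: filterS2 UZ sU => N ZN /= sN k kl.
apply: le_lt_trans sN; apply: ub_le_sup; first exact: ubound_values.
by exists k.
Qed.

End bounded.

Lemma norm_inf_lty_bounded v : (norm_inf X v < +oo)%E -> inf_bounded v.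
Proof. by rewrite /norm_inf; case: asboolP. Qed.

Lemma norm_inf_eq0 v : U [set N | forall k : 'I_(D N), coef v k = 0] ->
  norm_inf X v = 0%E.
Proof.
move=> v0; rewrite /norm_inf; case: asboolP => [_|[]]; last first.
  exists 1%N, [set N | forall k : 'I_(D N), coef v k = 0]; split => // N + k.
  by move=> ->; rewrite ComplexField.Normc.normc0 mul0r.
have -> : norm_inf_eps X v = cst 0%E.
  apply/funext => e; rewrite /norm_inf_eps.
  have s0 : normY_inf X (sigma_nbhd E e) v N @[N --> U] --> (0 : R).
    apply: cvg_near_cst; apply: filterS v0 => N vN /=; rewrite /normY_inf.
    set A := [set _ | _ in _].
    have [->|/set0P An0] := eqVneq A set0; first by rewrite sup0.
    rewrite (_ : A = [set 0]) ?sup1//; apply/seteqP; split.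
      by move=> _ [k _ <-] /=; rewrite vN ComplexField.Normc.normc0 mulr0.
    move=> _ ->; case: An0 => t At; case: (At) => k _ kt.
    by move: At; rewrite -{}kt vN ComplexField.Normc.normc0 mulr0.
  case: asboolP => [_|[]]; last exact: cvgP s0.
  by rewrite (cvg_lim _ s0).
by apply: cvg_lim => //; exact: cvg_cst.
Qed.

End ultra_vectors.


(** * The pairing *)

Section pairing_estimates.
Variables (R : realType) (H : completeNormedModType R[i]).
Variables (ip : inner_product H) (E : cyclic_operator ip).
Variables (X : finite_models E) (U : set_system nat) (FU : UltraFilter U).
Hypothesis Ucofinite : forall N0, U [set N | (N0 <= N)%N].
Variable P : refinement X U.
Variables (theta : (R[i] -> R[i]) -> R[i]) (K : nat).
Hypothesis theta_lin : forall a f g, CS X f -> CS X g ->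
  theta (fun x => a * f x + g x) = a^* * theta f + theta g.
Hypothesis theta_bnd : forall f, CS X f ->
  cabs (theta f) <= K%:R * norm_sigma E f.
Variable r : nat -> nat -> R.
Hypothesis r_grid : very_good_grid X U theta r.
Variables (n : nat -> nat) (eps : nat -> R).
Hypothesis ne_good : theta_good P theta r setT n eps.

Local Notation M := ((apM X)%:R : R).
Local Notation D := (apD X).
Local Notation lam := (apl X).
Local Notation u := (apu X).
Local Notation uth := (uN_theta P theta r n).
Local Notation T := (u_theta FU P theta r n).

Lemma coef_u_theta :
  U [set N | forall k : 'I_(D N), coef T k = ip (u k) (uth N)].
Proof. by apply: coef_Hu_of => N; exact: HN_uN_theta. Qed.

Lemma coef_Fu f :
  U [set N | forall k : 'I_(D N), coef (Fu X FU f) k = (xi k)%:C%C * f (lam k)].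
Proof.
have := coef_Hu_of X FU (fun N => HN_FN X f N).
by apply: filterS => N /= Hf k; rewrite Hf coef_FN.
Qed.

Lemma norm0_u_theta :
  U [set N | \sum_(k < D N) xi k * cabs (coef T k) <= K%:R].
Proof.
apply: filterS2 coef_u_theta (n_large FU ne_good 0) => N /= Tk nN.
under eq_bigr do rewrite Tk.
have := sum_uN_theta_le FU Ucofinite theta_lin theta_bnd r_grid ne_good nN
  (g := fun=> 1) (G := 1).
move=> h; rewrite -[leRHS]mulr1; apply: le_trans (h _ _ _) => //.
by under [leRHS]eq_bigr do rewrite mul1r.
Qed.

(** Cells with theta(B, 1) <> 0 meet the spectrum, so small ones miss a set at
    positive distance from it: the sum is eventually 0. *)
Lemma zero_good_u_theta : zero_good P T.
Proof.
move=> m Y _ [d d0 dP]; apply/infinitely_closeP => e e0.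
apply: filterS2 coef_u_theta
  (cell_diameter_small FU ne_good d0) => N /= Tk [nN nd].
have := sum_uN_theta_le FU Ucofinite theta_lin theta_bnd r_grid ne_good nN
  (g := fun k => (lam k \in rest P m Y)%:R) (G := 0).
rewrite mulr0 => /(_ (fun k => ler0n _ _) (lexx 0)) le0.
rewrite subr0 ger0_norm; last first.
  by apply: sumr_ge0 => k _; rewrite mulr_ge0 ?cabs_ge0 ?(ltW (xi_gt0 k)).
apply: le_lt_trans e0; rewrite big_mkcond /=.
apply: le_trans (le0 _); last first.
  move=> p k t0 pk; rewrite lern0 eqb0; apply/negP => /set_mem/dP dl.
  have := theta_cell_near_spectrum FU Ucofinite theta_lin theta_bnd r_grid
    ne_good t0 pk.
  by rewrite ltNge (le_trans (ltW nd)).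
apply: ler_sum => k _; case: ifP => _; rewrite ?mul1r ?mul0r ?Tk//.
Qed.

Lemma Hm0_u_theta : Hm0 P T.
Proof.
split; first exact: zero_good_u_theta.
apply/nat_boundedP; exists K; apply: filterS norm0_u_theta => N /= le_K.
rewrite ger0_norm// sumr_ge0// => k _.
by rewrite mulr_ge0 ?cabs_ge0 ?(ltW (xi_gt0 k)).
Qed.

Lemma class0_u_theta : class0 P T T.
Proof.
split; first exact: Hm0_u_theta.
apply/infinitely_closeP => e e0; apply: filterS (coef_Hu_sub X T T) => N /= Tk.
rewrite subr0 big1 ?normr0// => k _.
by rewrite Tk subrr ComplexField.Normc.normc0 mulr0.
Qed.

Lemma Hminf_Fu f : CS X f -> Hminf X (Fu X FU f).
Proof.
have cS := @square_compact _ _ _ _ X.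
move=> cf; have [C C0 fC] := compact_cabs_bounded cS cf.
apply: (@norm_inf_lty _ _ _ _ X _ FU _ (Num.truncn C).+1 _ (coef_Fu f)).
move=> N /= Fk k; rewrite Fk ComplexField.Normc.normcM cabs_real.
rewrite gtr0_norm ?xi_gt0// mulrAC divff ?gt_eqF ?xi_gt0// mul1r.
by rewrite (le_lt_trans (fC _ (lam_square k)))// truncnS_gt.
Qed.

Lemma class_inf_Fu f : CS X f -> class_inf X (Fu X FU f) (Fu X FU f).
Proof.
move=> cf; split; first exact: Hminf_Fu.
apply: norm_inf_eq0.
apply: filterS (coef_Hu_sub X (Fu X FU f) (Fu X FU f)) => N /= Fk k.
by rewrite Fk subrr.
Qed.

(** Write v = F(f) - d and w = u(theta) - e. The pairing with e is at most
    p ||e||_0, where p bounds the coordinates of v relative to xi. The pairing of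
    d with u(theta) is small since u(theta) lives near the spectrum, where d is
    uniformly small relative to xi, and ||u(theta)||_0 <= K. *)
Lemma pairing_close f v w : CS X f -> class_inf X (Fu X FU f) v ->
  class0 P T w -> infinitely_close (ipu v w) (theta f).
Proof.
move=> cf [vfin vF] [_ wT]; apply/infinitely_closeP.
move=> _ /gt0_complexP[e0 e00 ->].
have e30 : 0 < e0 / 3 by rewrite divr_gt0.
have [p [Z [UZ Zp]]] := norm_inf_lty_bounded vfin.
have dfin : (norm_inf X (Hu_sub (Fu X FU f) v) < +oo)%E by rewrite vF ltry.
have [p' [Z' [UZ' Zp']]] := norm_inf_lty_bounded dfin.
have K0 : 0 < K.+1%:R :> R by [].
have p0 : 0 < p.+1%:R :> R by [].
have [ed ed0 edP] := norm_inf0_near UZ' Zp' vF (divr_gt0 e30 K0).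
have we := (infinitely_closeP FU _ _).1 wT _ (divr_gt0 e30 p0).
have Fe := ip_FN_uN_theta_cvg FU Ucofinite theta_lin theta_bnd r_grid ne_good
  cf e30.
have Dv := coef_Hu_sub X (Fu X FU f) v; have Dw := coef_Hu_sub X T w.
apply: filterS (filterI (filterI UZ (filterI edP we)) (filterI (filterI Fe
  (filterI Dv Dw)) (filterI (filterI (coef_Fu f) coef_u_theta)
  (cell_diameter_small FU ne_good ed0)))).
move=> N /= [[ZN [dN wN]] [[FNe [vN eN]] [[Fk Tk] [nN nd]]]].
rewrite (ipuE X) cabsE ltcR.
have ab : ip (FN X f N) (uth N) =
    \sum_(k < D N) (coef (Fu X FU f) k)^* * coef T k.
  rewrite (parseval_ip X _ (HN_FN X f N)); apply: eq_bigr => k _.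
  by rewrite Fk Tk coef_FN.
pose s1 := \sum_(k < D N) (coef (Hu_sub (Fu X FU f) v) k)^* * coef T k.
pose s2 := \sum_(k < D N) (coef v k)^* * coef (Hu_sub T w) k.
have -> : \sum_(k < D N) (coef v k)^* * coef w k - theta f =
    (ip (FN X f N) (uth N) - theta f) - (s1 + s2).
  have -> : \sum_(k < D N) (coef v k)^* * coef w k =
      ip (FN X f N) (uth N) - (s1 + s2); last by ring.
  rewrite ab -big_split -sumrB /=; apply: eq_bigr => k _.
  by rewrite vN eN rmorphB /=; ring.
have s1e : cabs s1 < e0 / 3.
  apply: (@le_lt_trans _ _ (K%:R * (e0 / 3 / K.+1%:R))); last first.
    by rewrite mulrCA gtr_pMr// ltr_pdivrMr// mul1r ltr_nat.
  apply: (le_trans (cabs_sum _ _ _)).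
  have := sum_uN_theta_le FU Ucofinite theta_lin theta_bnd r_grid ne_good nN
    (g := fun k => (xi k)^-1 * cabs (coef (Hu_sub (Fu X FU f) v) k))
    (G := e0 / 3 / K.+1%:R).
  move=> h; apply: le_trans (h _ _ _).
  - apply: ler_sum => k _; rewrite ComplexField.Normc.normcM cabs_conj Tk.
    by rewrite mulrACA mulVf ?mul1r// gt_eqF// xi_gt0.
  - by move=> k; rewrite mulr_ge0 ?cabs_ge0// invr_ge0 ltW// xi_gt0.
  - by rewrite !divr_ge0// ltW.
  - move=> pc k t0 pk; apply: ltW; apply: dN; apply: ltW; apply: lt_trans nd.
    exact: (theta_cell_near_spectrum FU Ucofinite theta_lin theta_bnd r_grid
      ne_good t0 pk).
have s2e : cabs s2 < e0 / 3.
  apply: (@le_lt_trans _ _ (p%:R *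
      \sum_(k < D N) xi k * cabs (coef (Hu_sub T w) k))).
    apply: (le_trans (cabs_sum _ _ _)); rewrite mulr_sumr.
    apply: ler_sum => k _.
    rewrite ComplexField.Normc.normcM cabs_conj mulrA ler_wpM2r ?cabs_ge0//.
    by rewrite -ler_pdivrMr ?xi_gt0// ltW// Zp.
  move: wN; rewrite subr0 => /(le_lt_trans (ler_norm _)) wN.
  rewrite ltr_pdivlMr// in wN.
  apply: le_lt_trans wN; rewrite mulrC ler_wpM2l ?ler_nat//.
  by apply: sumr_ge0 => k _; rewrite mulr_ge0 ?cabs_ge0 ?(ltW (xi_gt0 k)).
apply: (le_lt_trans (le_normcD _ _)); rewrite normcN.
have := le_normcD s1 s2; lra.
Qed.

End pairing_estimates.

Lemma infinitely_close_unique (R : realType) (U : set_system nat)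
    (FU : UltraFilter U) (x : ultrapower FU R[i]) (a b : R[i]) :
  infinitely_close x a -> infinitely_close x b -> a = b.
Proof.
move=> xa xb; apply/eqP; rewrite -subr_eq0 -cabs_eq0 eq_le cabs_ge0 andbT.
apply/ler_addgt0Pr => e e0; rewrite add0r.
have e20 : 0 < (e / 2)%:C%C :> R[i] by rewrite ltcR divr_gt0.
have [N [/= xaN xbN]] := filter_ex (filterI (xa _ e20) (xb _ e20)).
rewrite -(subrKA (ultra_repr x N)) (le_trans (le_normcD _ _))// (splitr e).
rewrite cabs_distC; move: xaN xbN; rewrite !cabsE !ltcR => ? ?.
by rewrite lerD// ltW.
Qed.

Theorem theorem4p19 (R : realType) (H : completeNormedModType R[i])
  (Hsep : separable H) (ip : inner_product H) (E : cyclic_operator ip)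
  (X : finite_models E)
  (U : set_system nat) (FU : UltraFilter U)
  (Usquares : forall m : nat, (1 <= m)%N ->
     U [set N : nat | (1 <= N)%N /\ exists k : nat, N = (k ^ 2)%N /\ (m %| k)%N])
  (P : refinement X U)
  (theta : (R[i] -> R[i]) -> R[i])
  (theta_gd : generalized_distribution X theta)
  (r : nat -> nat -> R) (r_grid : very_good_grid X U theta r)
  (n : nat -> nat) (eps : nat -> R)
  (ne_good : theta_good P theta r setT n eps) :
  forall f : R[i] -> R[i], CS X f ->
    Some (theta f) =
    pairing (class_inf X (Fu X FU f)) (class0 P (u_theta FU P theta r n)).
Proof.
move=> f cf.
have Ucofinite N0 : U [set N | (N0 <= N)%N].
  apply: filterS (Usquares N0.+1 isT) => N /= [N1 [k [Nk /dvdn_leq le_k]]].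
  have k0 : (0 < k)%N by move: N1; rewrite Nk expn_gt0 orbF.
  by rewrite Nk (leq_trans (ltnW (le_k k0)))// expnS expn1 leq_pmulr.
have [theta_lin [K theta_bnd]] := theta_gd.
rewrite /pairing; set L := [set q | _].
have Lf : L (theta f).
  move=> v w vF wT.
  exact: (pairing_close Ucofinite theta_lin theta_bnd r_grid ne_good).
case: asboolP => [Ln0|[]]; last by exists (theta f).
congr Some; have Lx : L (xget 0 L) by apply: xgetPex; exists (theta f).
have F0 := class_inf_Fu FU cf.
have T0 := class0_u_theta FU Ucofinite theta_lin theta_bnd r_grid ne_good.
exact: infinitely_close_unique (Lf _ _ F0 T0) (Lx _ _ F0 T0).
Qed.
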